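(* Let $p,n\in\mathbb N$, $m\in\mathbb Z$, $\alpha\in\mathbb R$, $\beta>0$ with $\alpha+p\beta>0$, $\mu>0$, $-1\le B<A\le1$ and $\kappa=(1-A)/(1-B)$. If $f\in\mathcal A_p(n)$ satisfies $$\frac{\Theta_p^m(n;\alpha,\beta)f(z)}{z^p}\prec\frac{1+Az}{1+Bz}\quad(z\in\mathbb U),$$ then $$\operatorname{Re}\left\{(1-\mu)\frac{\Theta_p^m(n;\alpha,\beta)f(z)}{z^p}+\mu\frac{\Theta_p^{m+1}(n;\alpha,\beta)f(z)}{z^p}\right\}>\kappa\quad\text{for }|z|<R,$$ where $$R=\left[\frac{\sqrt{(\alpha+p\beta)^2+(\mu\beta n)^2}-\mu\beta n}{\alpha+p\beta}\right]^{1/n}.$$ The result is the best possible (the radius $R$ cannot be replaced by a larger one).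
   Context: $\mathbb U=\{z\in\mathbb C:|z|<1\}$. $\mathcal A_p(n)$ is the class of functions $f(z)=z^p+\sum_{k\ge p+n}a_kz^k$ which are analytic and $p$-valent in $\mathbb U$. For $m\in\mathbb Z$ the linear operator $\Theta_p^m(n;\alpha,\beta)$ on $\mathcal A_p(n)$ is $$\Theta_p^m(n;\alpha,\beta)f(z)=z^p+\sum_{k=p+n}^\infty\left(\frac{\alpha+k\beta}{\alpha+p\beta}\right)^m a_kz^k .$$ For functions $F,G$ analytic in $\mathbb U$, $F\prec G$ means $F=G\circ w$ for some analytic $w:\mathbb U\to\mathbb U$ with $w(0)=0$.
   Formalization: Best possible is stated as: for all fixed p, n, m, α, β, μ, no radius larger than R works for all A, B together (some A, B and f violate the inequality); sharpness for each individual pair A, B is false, e.g. p=n=1, m=0, α=0, β=μ=1, B=0, where the radius is at least 1/2 > √2−1. *)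

(* Defs.v *)
From Stdlib Require Import Reals ZArith List.
From Coquelicot Require Import Coquelicot.

Open Scope R_scope.

Definition in_U (z : C) : Prop := Cmod z < 1.

Definition analytic_U (f : C -> C) : Prop :=
  forall z, in_U z -> @ex_derive C_AbsRing C_NormedModule f z.

(** [zs] lists [N] roots of [f z = c] in the disc, counted with multiplicity:
    a value occurring [j] times in [zs] is a root of order at least [j]. *)
Definition has_roots (f : C -> C) (c : C) (N : nat) : Prop :=
  exists zs : list C, length zs = N /\ List.Forall in_U zs /\
    exists g : C -> C, analytic_U g /\
      forall z, in_U z ->
        (f z - c)%C =
        (fold_right Cmult (RtoC 1) (map (fun x => (z - x)%C) zs) * g z)%C.

(** No value is taken more than [p] times and some value is taken exactly
    [p] times, counted with multiplicity. *)
Definition p_valent (p : nat) (f : C -> C) : Prop :=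
  (forall c, ~ has_roots f c (S p)) /\ (exists c, has_roots f c p).

(** [v = z^p + sum_{k >= p+n} a_k z^k]; only the [a k] with [k >= p+n] matter. *)
Definition is_expansion (p n : nat) (a : nat -> C) (z v : C) : Prop :=
  @is_series C_AbsRing C_NormedModule
    (fun j => a (p + n + j)%nat * z ^ (p + n + j))%C (v - z ^ p)%C.

Definition class_A (p n : nat) (f : C -> C) : Prop :=
  analytic_U f /\ p_valent p f /\
  exists a : nat -> C, forall z, in_U z -> is_expansion p n a z (f z).

(** [iota] is definite description: the value at [z] of the series obtained
    from the (unique) coefficients of [f] by the multipliers. *)
Definition Theta (p n : nat) (m : Z) (alpha beta : R) (f : C -> C) (z : C) : C :=
  @iota C_CompleteNormedModule (fun v : C =>
    exists a : nat -> C,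
      (forall x, in_U x -> is_expansion p n a x (f x)) /\
      is_expansion p n
        (fun k => RtoC (powerRZ ((alpha + INR k * beta) / (alpha + INR p * beta)) m)
                  * a k)%C z v).

(** [g z / z^p] for [g z = z^p + O(z^(p+1))], with its removable singularity
    at the origin filled in. *)
Definition div_zpow (p : nat) (g : C -> C) (z : C) : C :=
  if Ceq_dec z (RtoC 0) then RtoC 1 else (g z / z ^ p)%C.

Definition subordinate (F G : C -> C) : Prop :=
  exists w : C -> C, analytic_U w /\ (forall z, in_U z -> in_U (w z)) /\
    w (RtoC 0) = RtoC 0 /\ forall z, in_U z -> F z = G (w z).

Definition Janowski (A B : R) (z : C) : C := ((1 + A * z) / (1 + B * z))%C.

Definition radius (p n : nat) (alpha beta mu : R) : R :=
  Rpower
    ((sqrt ((alpha + INR p * beta) ^ 2 + (mu * beta * INR n) ^ 2)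
      - mu * beta * INR n) / (alpha + INR p * beta))
    (/ INR n).

(* Main.v *)
Require Import Defs.
From Stdlib Require Import Reals ZArith List.
From Coquelicot Require Import Coquelicot.
From Stdlib Require Import Lra Lia Psatz Classical ClassicalEpsilon.

(** Put [q = Theta^m f / z^p = 1 + O(z^n)] and [g = q - kappa]. Subordination
    gives [Re g > 0], and the combination of [Theta^m] and [Theta^(m+1)] in the
    theorem is [kappa + Re (g + tau z g')], where [tau = mu beta / (alpha + p beta)].
    So the bound follows from [|z g'| <= 2 n r^n / (1 - r^(2n)) Re g] for [|z| = r].
    This inequality is proved by Ahlfors' method: in the coordinate [s + i t = log z]
    the metric [|g'| / Re g] has constant negative curvature and is compared,
    at a maximum of the quotient, with [a / sinh (a (L - s))] for [a < n] and
    [L < 0]; then [a -> n] and [L -> 0].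

    For sharpness take [B = -1] and let [q - 1] be a small multiple of a partial sum of
    [sum (theta z^n)^j] with [theta < 1] close to 1. Smallness makes [f] a
    perturbation of [z^p] whose divided differences of order [p] do not vanish,
    whence [f] is [p]-valent. At [z^n = -R^n / theta] the expression is at most [kappa]. *)

(** * Termwise differentiation of a power series in logarithmic polar coordinates *)

(** In the coordinate [s + i t = log z] the operator [z d/dz] is [d/ds], the comparison metric
    depends on [s] alone and everything is [2 * PI]-periodic in [t], so real calculus of series
    suffices. The half-strip [s < 0] is not compact, hence two perturbations: [L < 0] keeps the
    right end inside the disc, and [a < n] is needed on the left, since for [a = n] the quotient of
    the metrics has a limit at [s = -oo] that is in general not zero, and its supremum might not be
    attained. With [x = |z|^n] the method works as long as [2 tau n x < 1 - x^2]; the positive root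
    of the equality is [R^n]. The natural extremal quotient [(1 + z^n) / (1 - z^n)] meets the bound
    at [z^n = - R^n], but the [f] behind it need not be [p]-valent, for instance when [m] is very
    negative and its coefficients grow fast. Hence the truncation and the small factor [e];
    [A = 2 e - 1] makes [kappa = 1 - e] follow the scaling. The factor [theta] leaves room for the
    truncation error in the half-plane, at the price of a bad point slightly beyond [R], which any
    [R' > R] permits. *)

Lemma ex_series_Rmult_l (c : R) (a : nat -> R) :
  ex_series a -> ex_series (fun k => c * a k).
Proof. exact (@ex_series_scal_l R_AbsRing R_NormedModule c a). Qed.

Lemma ex_series_Rmult_r (c : R) (a : nat -> R) :
  ex_series a -> ex_series (fun k => a k * c).
Proof.
intros H. apply ex_series_ext with (2 := ex_series_Rmult_l c a H).
intros; apply Rmult_comm.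
Qed.

Lemma is_derive_quadratic (f : R -> R) (x l K d : R) :
  0 < d ->
  (forall h, Rabs h < d -> Rabs (f (x + h) - f x - h * l) <= K * h ^ 2) ->
  is_derive f x l.
Proof.
intros Hd H.
assert (HK : 0 <= K).
{ specialize (H (d / 2)). rewrite Rabs_pos_eq in H by lra.
  assert (H1 := H ltac:(lra)).
  pose proof (Rabs_pos (f (x + d / 2) - f x - d / 2 * l)).
  assert (0 <= K * (d / 2) ^ 2) by lra.
  assert (0 < (d / 2) ^ 2) by (apply pow_lt; lra). nra. }
apply is_derive_Reals. intros eps Heps.
assert (Hm : 0 < Rmin d (eps / (K + 1))).
{ apply Rmin_pos; [lra|]. apply Rdiv_lt_0_compat; lra. }
exists (mkposreal _ Hm). intros h Hh0 Hh. simpl in Hh.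
assert (Hh1 : Rabs h < d) by (apply Rlt_le_trans with (1 := Hh), Rmin_l).
assert (Hh2 : Rabs h < eps / (K + 1)) by (apply Rlt_le_trans with (1 := Hh), Rmin_r).
replace ((f (x + h) - f x) / h - l) with ((f (x + h) - f x - h * l) / h) by (field; lra).
unfold Rdiv. rewrite Rabs_mult, Rabs_inv.
assert (0 < Rabs h) by (apply Rabs_pos_lt; lra).
apply Rmult_lt_reg_r with (Rabs h); [lra|].
rewrite Rmult_assoc, Rinv_l, Rmult_1_r by lra.
apply Rle_lt_trans with (1 := H h Hh1).
rewrite <- (pow2_abs h).
assert (Rabs h * (K + 1) < eps).
{ apply Rlt_le_trans with (eps / (K + 1) * (K + 1)).
  - apply Rmult_lt_compat_r; lra.
  - right. field. lra. }
nra.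
Qed.

(** Taylor remainders that are quadratic in [h] with constants summable over [k] add up to a
    remainder quadratic in [h]. This takes the place of uniform convergence of the differentiated
    series. *)
Lemma is_derive_Series (u u1 : nat -> R -> R) (M : nat -> R) (x d : R) :
  0 < d -> ex_series M ->
  (forall k h, Rabs h < d -> Rabs (u k (x + h) - u k x - h * u1 k x) <= M k * h ^ 2) ->
  (forall h, Rabs h < d -> ex_series (fun k => u k (x + h))) ->
  ex_series (fun k => u1 k x) ->
  is_derive (fun y => Series (fun k => u k y)) x (Series (fun k => u1 k x)).
Proof.
intros Hd HM HT Hu Hu1.
apply is_derive_quadratic with (Series M) d; [exact Hd|].
intros h Hh.
assert (Hux : ex_series (fun k => u k x)).
{ apply ex_series_ext with (fun k => u k (x + 0)).
  - intros; now rewrite Rplus_0_r.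
  - apply Hu. rewrite Rabs_R0; lra. }
assert (E1 : ex_series (fun k => u k (x + h) - u k x)).
{ apply (ex_series_minus (V := R_NormedModule)); auto. }
assert (E2 : ex_series (fun k => h * u1 k x)).
{ apply ex_series_Rmult_l; auto. }
rewrite <- Series_scal_l, <- Series_minus, <- Series_minus by auto.
rewrite <- Series_scal_r.
apply Rle_trans with (Series (fun k => Rabs (u k (x + h) - u k x - h * u1 k x))).
- apply Series_Rabs.
  apply (ex_series_le (V := R_CompleteNormedModule)) with (fun k => M k * h ^ 2).
  + intros k. unfold norm; simpl. unfold abs; simpl. rewrite Rabs_Rabsolu. now apply HT.
  + apply ex_series_Rmult_r; auto.
- apply Series_le.
  + intros k. split; [apply Rabs_pos|now apply HT].
  + apply ex_series_Rmult_r; auto.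
Qed.

(** Two uses of the mean value theorem; the constant is [K] instead of [K / 2], which is enough for
    a summable majorant. *)
Lemma taylor2 (f f1 f2 : R -> R) (x h K : R) :
  (forall y, is_derive f y (f1 y)) -> (forall y, is_derive f1 y (f2 y)) ->
  (forall y, Rabs (y - x) <= Rabs h -> Rabs (f2 y) <= K) ->
  Rabs (f (x + h) - f x - h * f1 x) <= K * h ^ 2.
Proof.
intros H1 H2 HK.
destruct (MVT_gen f x (x + h) f1) as [c [Hc E]].
{ intros; apply H1. }
{ intros y _. apply continuity_pt_filterlim, (ex_derive_continuous (K := R_AbsRing) (V := R_NormedModule)).
  eexists; apply H1. }
destruct (MVT_gen f1 x c f2) as [e [He E']].
{ intros; apply H2. }
{ intros y _. apply continuity_pt_filterlim, (ex_derive_continuous (K := R_AbsRing) (V := R_NormedModule)).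
  eexists; apply H2. }
rewrite E. replace (f1 c * (x + h - x) - h * f1 x) with ((f1 c - f1 x) * h) by ring.
rewrite E', 2!Rabs_mult.
assert (Hch : Rabs (c - x) <= Rabs h).
{ revert Hc. unfold Rmin, Rmax, Rabs. repeat destruct Rle_dec; repeat destruct Rcase_abs; lra. }
assert (Hex : Rabs (e - x) <= Rabs h).
{ apply Rle_trans with (2 := Hch).
  revert He. unfold Rmin, Rmax, Rabs. repeat destruct Rle_dec; repeat destruct Rcase_abs; lra. }
specialize (HK e Hex). rewrite <- (pow2_abs h).
pose proof (Rabs_pos (f2 e)). pose proof (Rabs_pos h). pose proof (Rabs_pos (c - x)).
simpl. rewrite Rmult_1_r, <- Rmult_assoc.
apply Rmult_le_compat_r; [lra|].
apply Rmult_le_compat; lra.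
Qed.

(** Since [|z| = exp s], this says that the power series with coefficients [al] has radius of
    convergence at least 1. *)
Definition summable (al : nat -> R) : Prop :=
  forall s, s < 0 -> ex_series (fun k => Rabs (al k) * exp (INR k * s)).

Definition term (al be : nat -> R) (s t : R) (k : nat) : R :=
  exp (INR k * s) * (al k * cos (INR k * t) - be k * sin (INR k * t)).

(** The real part of [sum_k (al k + i be k) z^k] at [z = exp (s + i t)]; its
    imaginary part is [re_sum be (- al)]. *)
Definition re_sum (al be : nat -> R) (s t : R) : R := Series (term al be s t).

(** The action of [z d/dz], that is of [d/ds], on coefficients. *)
Definition kmul (al : nat -> R) (k : nat) : R := INR k * al k.
Definition nopp (al : nat -> R) (k : nat) : R := - al k.

Lemma summable_le al be :
  (forall k, Rabs (al k) <= Rabs (be k)) -> summable be -> summable al.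
Proof.
intros H Hb s Hs.
apply (ex_series_le (V := R_CompleteNormedModule)) with (2 := Hb s Hs).
intros k. unfold norm; simpl. unfold abs; simpl.
rewrite Rabs_pos_eq by (apply Rmult_le_pos; [apply Rabs_pos|left; apply exp_pos]).
apply Rmult_le_compat_r; [left; apply exp_pos|apply H].
Qed.

Lemma summable_tail al : summable al -> summable (fun k => if k then 0 else al k).
Proof.
apply summable_le. intros [|k]; [rewrite Rabs_R0; apply Rabs_pos|lra].
Qed.

(** Half of the exponent absorbs the new factor: [k exp (k s / 2) <= 2 / - s], from
    [exp x >= 1 + x]. *)
Lemma summable_kmul al : summable al -> summable (kmul al).
Proof.
intros H s Hs.
apply (ex_series_le (V := R_CompleteNormedModule)) with
  (fun k => (2 / - s) * (Rabs (al k) * exp (INR k * (s / 2)))).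
- intros k. unfold norm; simpl. unfold abs; simpl.
  rewrite Rabs_pos_eq by (apply Rmult_le_pos; [apply Rabs_pos|left; apply exp_pos]).
  unfold kmul. rewrite Rabs_mult, (Rabs_pos_eq (INR k)) by apply pos_INR.
  replace (INR k * s) with (INR k * (s / 2) + INR k * (s / 2)) by field.
  rewrite exp_plus.
  assert (Hk : INR k * exp (INR k * (s / 2)) <= 2 / - s).
  { assert (E := exp_ineq1_le (INR k * (- s / 2))).
    assert (E2 : exp (INR k * (- s / 2)) * exp (INR k * (s / 2)) = 1).
    { rewrite <- exp_plus. rewrite <- exp_0. f_equal. field. }
    pose proof (exp_pos (INR k * (s / 2))).
    apply Rmult_le_reg_r with (- s / 2); [lra|].
    replace (2 / - s * (- s / 2)) with 1 by (field; lra).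
    rewrite <- E2. nra. }
  pose proof (exp_pos (INR k * (s / 2))). pose proof (Rabs_pos (al k)).
  replace (INR k * Rabs (al k) * (exp (INR k * (s / 2)) * exp (INR k * (s / 2))))
   with ((INR k * exp (INR k * (s / 2))) * (Rabs (al k) * exp (INR k * (s / 2)))) by ring.
  apply Rmult_le_compat_r; [|exact Hk]. apply Rmult_le_pos; lra.
- apply ex_series_Rmult_l. apply H. lra.
Qed.

Lemma summable_nopp al : summable al -> summable (nopp al).
Proof.
intros H s Hs. apply ex_series_ext with (2 := H s Hs).
intros k. unfold nopp. now rewrite Rabs_Ropp.
Qed.

Lemma summable_plus al be :
  summable al -> summable be ->
  forall s, s < 0 -> ex_series (fun k => (Rabs (al k) + Rabs (be k)) * exp (INR k * s)).
Proof.
intros Ha Hb s Hs.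
apply ex_series_ext with (fun k => plus (Rabs (al k) * exp (INR k * s)) (Rabs (be k) * exp (INR k * s))).
- intros k. unfold plus; simpl. ring.
- apply (ex_series_plus (V := R_NormedModule)); auto.
Qed.

Lemma trig_bound a b x : Rabs (a * cos x - b * sin x) <= Rabs a + Rabs b.
Proof.
apply Rle_trans with (1 := Rabs_triang _ _).
rewrite Rabs_Ropp, 2!Rabs_mult.
pose proof (Rabs_pos a). pose proof (Rabs_pos b).
assert (Rabs (cos x) <= 1) by (apply Rabs_le, COS_bound).
assert (Rabs (sin x) <= 1) by (apply Rabs_le, SIN_bound). nra.
Qed.

Lemma term_bound al be s t k :
  Rabs (term al be s t k) <= (Rabs (al k) + Rabs (be k)) * exp (INR k * s).
Proof.
unfold term. rewrite Rabs_mult, (Rabs_pos_eq (exp _)) by (left; apply exp_pos).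
rewrite Rmult_comm. apply Rmult_le_compat_r; [left; apply exp_pos|apply trig_bound].
Qed.

Lemma ex_series_term al be s t :
  summable al -> summable be -> s < 0 -> ex_series (term al be s t).
Proof.
intros Ha Hb Hs.
apply (ex_series_le (V := R_CompleteNormedModule)) with
  (fun k => (Rabs (al k) + Rabs (be k)) * exp (INR k * s)).
- intros k. apply term_bound.
- now apply summable_plus.
Qed.

Lemma is_derive_term_s al be s t k :
  is_derive (fun s => term al be s t k) s (term (kmul al) (kmul be) s t k).
Proof.
unfold term, kmul. auto_derive; [exact I|]. ring.
Qed.

Lemma is_derive_term_t al be s t k :
  is_derive (fun t => term al be s t k) t (term (nopp (kmul be)) (kmul al) s t k).
Proof.
unfold term, kmul, nopp. auto_derive; [exact I|]. ring.
Qed.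

Lemma is_derive_re_sum_s al be s t :
  summable al -> summable be -> s < 0 ->
  is_derive (fun s => re_sum al be s t) s (re_sum (kmul al) (kmul be) s t).
Proof.
intros Ha Hb Hs. unfold re_sum.
(* Points within [- s / 2] of [s] stay below [s / 2], so second derivatives there are bounded by
   their majorant at [s / 2]. *)
pose (M := fun k => (Rabs (kmul (kmul al) k) + Rabs (kmul (kmul be) k)) * exp (INR k * (s / 2))).
apply (is_derive_Series (fun k s => term al be s t k)
         (fun k s => term (kmul al) (kmul be) s t k) M s (- s / 2)).
- lra.
- apply summable_plus; try lra; now repeat apply summable_kmul.
- intros k h Hh. apply (taylor2 (fun s => term al be s t k) (fun s => term (kmul al) (kmul be) s t k)
    (fun s => term (kmul (kmul al)) (kmul (kmul be)) s t k)).
  + intros; apply is_derive_term_s.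
  + intros; apply is_derive_term_s.
  + intros y Hy. apply Rle_trans with (1 := term_bound _ _ _ _ _).
    apply Rmult_le_compat_l.
    * apply Rplus_le_le_0_compat; apply Rabs_pos.
    * destruct (Req_dec (INR k * y) (INR k * (s / 2))) as [->|]; [lra|].
      left. apply exp_increasing.
      assert (y < s / 2). { revert Hy Hh. unfold Rabs. repeat destruct Rcase_abs; lra. }
      pose proof (pos_INR k). nra.
- intros h Hh. apply ex_series_term; auto.
  revert Hh. unfold Rabs. repeat destruct Rcase_abs; lra.
- apply ex_series_term; auto; now apply summable_kmul.
Qed.

Lemma is_derive_re_sum_t al be s t :
  summable al -> summable be -> s < 0 ->
  is_derive (fun t => re_sum al be s t) t (re_sum (nopp (kmul be)) (kmul al) s t).
Proof.
intros Ha Hb Hs. unfold re_sum.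
(* Moving [t] does not change [|z|]: the majorant can be taken at [s] itself, and the range [1] for
   the increment is arbitrary. *)
pose (M := fun k => (Rabs (kmul (kmul al) k) + Rabs (kmul (kmul be) k)) * exp (INR k * s)).
apply (is_derive_Series (fun k t => term al be s t k)
         (fun k t => term (nopp (kmul be)) (kmul al) s t k) M t 1).
- lra.
- apply summable_plus; try lra; now repeat apply summable_kmul.
- intros k h Hh. apply (taylor2 (fun t => term al be s t k) (fun t => term (nopp (kmul be)) (kmul al) s t k)
    (fun t => term (nopp (kmul (kmul al))) (kmul (nopp (kmul be))) s t k)).
  + intros; apply is_derive_term_t.
  + intros; apply is_derive_term_t.
  + intros y Hy. apply Rle_trans with (1 := term_bound _ _ _ _ _).
    unfold M, nopp, kmul. rewrite Rabs_Ropp.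
    replace (INR k * - (INR k * be k)) with (- (INR k * (INR k * be k))) by ring.
    rewrite Rabs_Ropp. lra.
- intros h Hh. apply ex_series_term; auto.
- apply ex_series_term; auto; [apply summable_nopp|]; now apply summable_kmul.
Qed.

(** * The curvature comparison *)

(** Without a maximum, every point [p] has a point [q] of the rectangle such that [W] stays below
    [W q] near [p]. Finitely many of these neighbourhoods cover the rectangle, and the largest of
    the finitely many values [W q] would be exceeded at its own [q]. *)
Lemma rectangle_max (W : R -> R -> R) (a b c d : R) :
  a <= b -> c <= d ->
  (forall x y, a <= x <= b -> c <= y <= d -> continuous (fun p : R * R => W (fst p) (snd p)) (x, y)) ->
  exists x y, a <= x <= b /\ c <= y <= d /\
    forall x' y', a <= x' <= b -> c <= y' <= d -> W x' y' <= W x y.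
Proof.
intros Hab Hcd Hcont. apply NNPP. intros Hno.
assert (Hbig : forall p : R * R, exists q : R * R * posreal,
  a <= fst p <= b -> c <= snd p <= d ->
  (a <= fst (fst q) <= b /\ c <= snd (fst q) <= d) /\
  forall x' y', a <= x' <= b -> c <= y' <= d ->
    Rabs (x' - fst p) < snd q -> Rabs (y' - snd p) < snd q ->
    W x' y' < W (fst (fst q)) (snd (fst q))).
{ intros [x y]. simpl.
  destruct (classic (a <= x <= b /\ c <= y <= d)) as [[Hx Hy]|Hn].
  2: { exists ((0, 0), mkposreal 1 Rlt_0_1). tauto. }
  assert (exists u v, a <= u <= b /\ c <= v <= d /\ W x y < W u v) as (u & v & Hu & Hv & Huv).
  { apply NNPP. intros Hn. apply Hno. exists x, y. split; [exact Hx|split; [exact Hy|]].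
    intros x' y' Hx' Hy'. apply Rnot_lt_le. intros Hlt. apply Hn. now exists x', y'. }
  assert (He : 0 < W u v - W x y) by lra.
  assert (Hxy := Hcont x y Hx Hy).
  apply filterlim_locally with (eps := mkposreal _ He) in Hxy. destruct Hxy as [de Hde].
  exists ((u, v), de). simpl. intros _ _. split; [tauto|].
  intros x' y' _ _ H1 H2.
  assert (Hb : Rabs (W x' y' - W x y) < W u v - W x y) by (apply (Hde (x', y')); split; assumption).
  apply Rabs_def2 in Hb. lra. }
pose (phi := fun p => proj1_sig (constructive_indefinite_description _ (Hbig p))).
pose proof (fun p => proj2_sig (constructive_indefinite_description _ (Hbig p))) as Hphi.
change (forall p, (fun q : R * R * posreal =>  a <= fst p <= b -> c <= snd p <= d ->
  (a <= fst (fst q) <= b /\ c <= snd (fst q) <= d) /\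
  forall x' y', a <= x' <= b -> c <= y' <= d ->
    Rabs (x' - fst p) < snd q -> Rabs (y' - snd p) < snd q ->
    W x' y' < W (fst (fst q)) (snd (fst q))) (phi p)) in Hphi. cbv beta in Hphi.
apply (compactness_list 2 (a, (c, tt)) (b, (d, tt))
  (fun t => snd (phi (fst t, fst (snd t))))).
intros [l Hl].
set (V := fun t : Compactness.Tn 2 R => let q := fst (phi (fst t, fst (snd t))) in W (fst q) (snd q)).
set (bd := fun t : Compactness.Tn 2 R => a <= fst t <= b /\ c <= fst (snd t) <= d).
assert (Hmax : forall l : list (Compactness.Tn 2 R),
   (exists t, In t l /\ bd t) ->
   exists t, In t l /\ bd t /\ forall t', In t' l -> bd t' -> V t' <= V t).
{ clear. induction l as [|x l IH]; [intros [t [[] _]]|].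
  intros Hex.
  destruct (classic (exists t, In t l /\ bd t)) as [He|He].
  - destruct (IH He) as (t & Ht & Hbt & Hm).
    destruct (classic (bd x /\ V t < V x)) as [[Hx Hlt]|Hn].
    + exists x. split; [now left|split; [exact Hx|]].
      intros t' [->|Ht'] Hb'; [lra|]. specialize (Hm t' Ht' Hb'). lra.
    + exists t. split; [now right|split; [exact Hbt|]].
      intros t' [->|Ht'] Hb'; [|now apply Hm].
      apply Rnot_lt_le. intros Hlt. apply Hn. now split.
  - destruct Hex as (t & [->|Ht] & Hb).
    + exists t. split; [now left|split; [exact Hb|]].
      intros t' [->|Ht'] Hb'; [lra|]. exfalso. apply He. now exists t'.
    + exfalso. apply He. now exists t. }
assert (Hcov : forall x y, a <= x <= b -> c <= y <= d ->
   exists t, In t l /\ bd t /\ W x y < V t).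
{ intros x y Hx Hy. destruct (Hl (x, (y, tt))) as ([t1 [t2 []]] & Hin & (Hb1 & Hb2 & _) & (Hc1 & Hc2 & _)).
  - simpl. tauto.
  - exists (t1, (t2, tt)). split; [exact Hin|]. split; [now split|].
    unfold V. simpl. simpl in *. apply (Hphi (t1, t2)); simpl; auto. }
destruct (Hmax l) as (t & Hin & Hb & Hm).
{ destruct (Hcov a c) as (t & H1 & H2 & _); try lra. now exists t. }
destruct (Hphi (fst t, fst (snd t))) as [[Hq1 Hq2] _]; try apply Hb.
destruct (Hcov _ _ Hq1 Hq2) as (t' & Hin' & Hb' & Hlt).
specialize (Hm t' Hin' Hb'). unfold V in Hlt, Hm. lra.
Qed.

(** If [l < 0], then [f1] is negative just to the right of its zero [x], and [f] drops below [f x]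
    there. *)
Lemma second_derivative_min (f f1 : R -> R) (x l d : R) :
  0 < d -> (forall y, Rabs (y - x) < d -> is_derive f y (f1 y)) ->
  is_derive f1 x l -> (forall y, Rabs (y - x) < d -> f x <= f y) ->
  f1 x = 0 /\ 0 <= l.
Proof.
intros Hd H1 H2 Hmin.
assert (E : f1 x = 0).
{ assert (Hx : Rabs (x - x) < d) by (rewrite Rminus_diag, Rabs_R0; lra).
  assert (Hx1 := H1 x Hx). apply is_derive_Reals in Hx1.
  pose (pr := exist (fun l => derivable_pt_abs f x l) (f1 x) Hx1 : derivable_pt f x).
  change (derive_pt f x pr = 0).
  apply (deriv_minimum f (x - d) (x + d) x pr); try lra.
  intros y Ha Hb. apply Hmin. apply Rabs_def1; lra. }
split; [exact E|].
apply Rnot_lt_le. intros Hl.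
apply is_derive_Reals in H2.
destruct (H2 (- l / 2) ltac:(lra)) as [e He].
set (h := Rmin (d / 2) (e / 2)).
assert (Hh : 0 < h) by (apply Rmin_pos; [lra|destruct e; simpl; lra]).
assert (Hhd : h < d) by (apply Rle_lt_trans with (1 := Rmin_l _ _); lra).
assert (Hhe : h < e) by (apply Rle_lt_trans with (1 := Rmin_r _ _); destruct e; simpl in *; lra).
destruct (MVT_cor2 f f1 x (x + h)) as [c [Ec Hc]]; [lra| |].
{ intros y Hy. apply is_derive_Reals, H1. apply Rabs_def1; lra. }
assert (Hge := Hmin (x + h)). replace (x + h - x) with h in Hge, Ec by ring.
rewrite (Rabs_pos_eq h) in Hge by lra. specialize (Hge Hhd).
assert (Hq := He (c - x) ltac:(lra)).
rewrite Rabs_pos_eq in Hq by lra. specialize (Hq ltac:(lra)).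
replace (x + (c - x)) with c in Hq by ring. rewrite E, Rminus_0_r in Hq.
apply Rabs_def2 in Hq.
assert (f1 c < 0).
{ replace (f1 c) with (f1 c / (c - x) * (c - x)) by (field; lra). nra. }
nra.
Qed.

(** A maximum [M] of [(u^2 + v^2) sg / p^2] is turned into a minimum with value 0 of
    [M p^2 - (u^2 + v^2) sg], which avoids differentiating a quotient or a logarithm twice. The
    conclusions are the first and second order conditions at that minimum, along one coordinate
    direction. *)
Lemma functional_min (p pd u ud v vd sg sgd : R -> R) (x pdd udd vdd sgdd M d : R) :
  0 < d ->
  (forall y, Rabs (y - x) < d -> is_derive p y (pd y)) -> is_derive pd x pdd ->
  (forall y, Rabs (y - x) < d -> is_derive u y (ud y)) -> is_derive ud x udd ->
  (forall y, Rabs (y - x) < d -> is_derive v y (vd y)) -> is_derive vd x vdd ->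
  (forall y, Rabs (y - x) < d -> is_derive sg y (sgd y)) -> is_derive sgd x sgdd ->
  (forall y, Rabs (y - x) < d -> 0 <= M * p y ^ 2 - (u y ^ 2 + v y ^ 2) * sg y) ->
  M * p x ^ 2 = (u x ^ 2 + v x ^ 2) * sg x ->
  2 * M * p x * pd x = 2 * (u x * ud x + v x * vd x) * sg x + (u x ^ 2 + v x ^ 2) * sgd x /\
  0 <= 2 * M * (pd x ^ 2 + p x * pdd)
       - 2 * (ud x ^ 2 + u x * udd + vd x ^ 2 + v x * vdd) * sg x
       - 4 * (u x * ud x + v x * vd x) * sgd x - (u x ^ 2 + v x ^ 2) * sgdd.
Proof.
intros Hd P1 P2 U1 U2 V1 V2 S1 S2 Hmin Heq.
destruct (second_derivative_min
  (fun y => M * p y ^ 2 - (u y ^ 2 + v y ^ 2) * sg y)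
  (fun y => 2 * M * p y * pd y - (2 * (u y * ud y + v y * vd y) * sg y + (u y ^ 2 + v y ^ 2) * sgd y))
  x (2 * M * (pd x ^ 2 + p x * pdd)
       - 2 * (ud x ^ 2 + u x * udd + vd x ^ 2 + v x * vdd) * sg x
       - 4 * (u x * ud x + v x * vd x) * sgd x - (u x ^ 2 + v x ^ 2) * sgdd) d) as [A B].
- exact Hd.
- intros y Hy. auto_derive.
  + repeat split; eexists; eauto.
  + rewrite (is_derive_unique (fun y : R => p y) _ _ (P1 y Hy)), (is_derive_unique (fun y : R => u y) _ _ (U1 y Hy)),
      (is_derive_unique (fun y : R => v y) _ _ (V1 y Hy)), (is_derive_unique (fun y : R => sg y) _ _ (S1 y Hy)). ring.
- assert (Hx : Rabs (x - x) < d) by (rewrite Rminus_diag, Rabs_R0; lra).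
  auto_derive.
  + repeat split; eexists; eauto.
  + rewrite (is_derive_unique (fun y : R => p y) _ _ (P1 x Hx)), (is_derive_unique (fun y : R => u y) _ _ (U1 x Hx)),
      (is_derive_unique (fun y : R => v y) _ _ (V1 x Hx)), (is_derive_unique (fun y : R => sg y) _ _ (S1 x Hx)).
    rewrite (is_derive_unique (fun y : R => pd y) _ _ P2), (is_derive_unique (fun y : R => ud y) _ _ U2),
      (is_derive_unique (fun y : R => vd y) _ _ V2), (is_derive_unique (fun y : R => sgd y) _ _ S2). ring.
- intros y Hy. specialize (Hmin y Hy). lra.
- split; [lra|exact B].
Qed.

(** [g' = u + i v] for a holomorphic [g] of real part [p], [g'' = u1 + i v1],
    [g''' = u2 + i v2]: the two second-order conditions add up to the curvature
    inequality, the third derivatives cancelling by harmonicity. *)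
Lemma curvature_algebra (a M p u v u1 v1 u2 v2 sg sgd sgdd : R) :
  0 < sg -> 0 < u ^ 2 + v ^ 2 ->
  M * p ^ 2 = (u ^ 2 + v ^ 2) * sg ->
  sgd ^ 2 - sg * sgdd = 2 * a ^ 2 * sg ->
  2 * M * p * u = 2 * (u * u1 + v * v1) * sg + (u ^ 2 + v ^ 2) * sgd ->
  2 * M * p * (- v) = 2 * (u * (- v1) + v * u1) * sg + (u ^ 2 + v ^ 2) * 0 ->
  0 <= 2 * M * (u ^ 2 + p * u1) - 2 * (u1 ^ 2 + u * u2 + v1 ^ 2 + v * v2) * sg
       - 4 * (u * u1 + v * v1) * sgd - (u ^ 2 + v ^ 2) * sgdd ->
  0 <= 2 * M * ((- v) ^ 2 + p * (- u1))
       - 2 * ((- v1) ^ 2 + u * (- u2) + u1 ^ 2 + v * (- v2)) * sg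
       - 4 * (u * (- v1) + v * u1) * 0 - (u ^ 2 + v ^ 2) * 0 ->
  M <= a ^ 2.
Proof.
intros Hs HQ HM HS H1 H2 H3 H4.
set (Q := u ^ 2 + v ^ 2) in *.
set (A := u * u1 + v * v1) in *. set (B := u * (- v1) + v * u1) in *.
(* [A - i B] is the conjugate of [g'] times [g'']. *)
assert (HAB : A ^ 2 + B ^ 2 = Q * (u1 ^ 2 + v1 ^ 2)) by (unfold A, B, Q; ring).
assert (H5 : 0 <= 2 * M * Q - 4 * (u1 ^ 2 + v1 ^ 2) * sg - 4 * A * sgd - Q * sgdd)
  by (unfold Q in *; lra).
(* After multiplication by [Q * sg], the second derivatives enter only through [2 * A * sg] and
   [2 * B * sg], and the first order conditions [H1] and [H2] give these two. *)
assert (H6 : 0 <= Q * sg * (2 * M * Q - 4 * (u1 ^ 2 + v1 ^ 2) * sg - 4 * A * sgd - Q * sgdd)).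
{ apply Rmult_le_pos; [apply Rmult_le_pos; lra|exact H5]. }
replace (Q * sg * (2 * M * Q - 4 * (u1 ^ 2 + v1 ^ 2) * sg - 4 * A * sgd - Q * sgdd))
  with (2 * M * Q ^ 2 * sg - (2 * A * sg) ^ 2 - (2 * B * sg) ^ 2
        - 2 * (2 * A * sg) * Q * sgd - Q ^ 2 * sg * sgdd) in H6.
2: { replace (Q * sg * (2 * M * Q - 4 * (u1 ^ 2 + v1 ^ 2) * sg - 4 * A * sgd - Q * sgdd))
     with (2 * M * Q ^ 2 * sg - 4 * (Q * (u1 ^ 2 + v1 ^ 2)) * sg ^ 2 - 4 * A * sgd * Q * sg - Q ^ 2 * sg * sgdd) by ring.
     rewrite <- HAB. ring. }
replace (2 * A * sg) with (2 * M * p * u - Q * sgd) in H6 by lra.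
replace (2 * B * sg) with (- (2 * M * p * v)) in H6 by lra.
assert (H7 : 0 <= 2 * Q ^ 2 * sg * (a ^ 2 - M)).
{ replace (2 * Q ^ 2 * sg * (a ^ 2 - M)) with
   (2 * M * Q ^ 2 * sg - 4 * M * Q * (Q * sg) + Q ^ 2 * (2 * a ^ 2 * sg)) by ring.
  rewrite <- HS, <- HM. unfold Q in *. nra. }
assert (0 < 2 * Q ^ 2 * sg) by (apply Rmult_lt_0_compat; [|exact Hs]; nra).
nra.
Qed.

(** [sinh (a (L - s)) ^ 2] *)
Definition sinh2 (a L s : R) : R := (exp (2 * a * (L - s)) + exp (- (2 * a * (L - s))) - 2) / 4.
Definition sinh2_d (a L s : R) : R := - a * (exp (2 * a * (L - s)) - exp (- (2 * a * (L - s)))) / 2.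
Definition sinh2_dd (a L s : R) : R := a ^ 2 * (exp (2 * a * (L - s)) + exp (- (2 * a * (L - s)))).

Lemma is_derive_sinh2 a L s : is_derive (sinh2 a L) s (sinh2_d a L s).
Proof. unfold sinh2, sinh2_d. auto_derive; [exact I|]. unfold Rminus. field. Qed.

Lemma is_derive_sinh2_d a L s : is_derive (sinh2_d a L) s (sinh2_dd a L s).
Proof. unfold sinh2_d, sinh2_dd. auto_derive; [exact I|]. unfold Rminus. field. Qed.

(** Liouville's equation [(ln sg)'' = - 2 a^2 / sg] for [sg = sinh2 a L], without division. It says
    that the metric [a / sinh (a (L - s))] has curvature -1, the curvature of [|g'| / Re g]. *)
Lemma sinh2_curvature a L s :
  sinh2_d a L s ^ 2 - sinh2 a L s * sinh2_dd a L s = 2 * a ^ 2 * sinh2 a L s.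
Proof.
unfold sinh2, sinh2_d, sinh2_dd.
assert (E : exp (2 * a * (L - s)) * exp (- (2 * a * (L - s))) = 1).
{ rewrite <- exp_plus, Rplus_opp_r. apply exp_0. }
set (x := exp (2 * a * (L - s))) in *. set (y := exp (- (2 * a * (L - s)))) in *.
replace ((- a * (x - y) / 2) ^ 2) with (a ^ 2 * ((x + y) ^ 2 - 4 * (x * y)) / 4) by field.
rewrite E. field.
Qed.

Lemma sinh2_pos a L s : 0 < a -> s < L -> 0 < sinh2 a L s.
Proof.
intros Ha Hs. unfold sinh2.
assert (H : 0 < 2 * a * (L - s)) by (apply Rmult_lt_0_compat; lra).
set (w := 2 * a * (L - s)) in *.
assert (E : exp w * exp (- w) = 1) by (rewrite <- exp_plus, Rplus_opp_r; apply exp_0).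
assert (1 < exp w) by (rewrite <- exp_0; now apply exp_increasing).
pose proof (exp_pos (- w)).
assert (exp w + exp (- w) - 2 = (exp w - 1) ^ 2 * exp (- w)).
{ replace ((exp w - 1) ^ 2 * exp (- w)) with (exp w * (exp w * exp (- w)) - 2 * (exp w * exp (- w)) + exp (- w)) by ring.
  rewrite E. ring. }
assert (0 < (exp w - 1) ^ 2) by (apply pow_lt; lra). nra.
Qed.

Lemma sinh2_diag a L : sinh2 a L L = 0.
Proof. unfold sinh2. rewrite Rminus_diag, Rmult_0_r, Ropp_0, exp_0. lra. Qed.

(** The bound does not involve [L], so that the left end of the rectangle can be chosen
    independently of [L]. *)
Lemma sinh2_le_exp a L s : 0 < a -> L < 0 -> s <= L -> sinh2 a L s <= exp (- 2 * a * s).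
Proof.
intros Ha HL Hs. unfold sinh2.
assert (0 <= 2 * a * (L - s)) by (apply Rmult_le_pos; lra).
assert (exp (- (2 * a * (L - s))) <= 1).
{ rewrite <- exp_0. destruct (Req_dec (- (2 * a * (L - s))) 0) as [->|]; [lra|].
  left; apply exp_increasing; lra. }
assert (exp (2 * a * (L - s)) <= exp (- 2 * a * s)).
{ left; apply exp_increasing. nra. }
pose proof (exp_pos (-2 * a * s)). lra.
Qed.

(** * Cauchy-Riemann relations, size and joint continuity of the sums *)

Definition im_sum (al be : nat -> R) (s t : R) : R := re_sum be (nopp al) s t.

Lemma re_sum_ext al be al' be' s t :
  (forall k, al k = al' k) -> (forall k, be k = be' k) -> re_sum al be s t = re_sum al' be' s t.
Proof.
intros Ha Hb. unfold re_sum. apply Series_ext. intros k. unfold term. now rewrite Ha, Hb.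
Qed.

Lemma re_sum_nopp al be s t : re_sum (nopp al) (nopp be) s t = - re_sum al be s t.
Proof.
unfold re_sum. rewrite <- Series_opp. apply Series_ext. intros k. unfold term, nopp. ring.
Qed.

Lemma is_derive_re_sum_t' al be s t :
  summable al -> summable be -> s < 0 ->
  is_derive (fun t => re_sum al be s t) t (- im_sum (kmul al) (kmul be) s t).
Proof.
intros Ha Hb Hs. unfold im_sum. rewrite <- re_sum_nopp.
erewrite re_sum_ext; [apply is_derive_re_sum_t; eauto| reflexivity|].
intros k; unfold nopp, kmul; ring.
Qed.

Lemma is_derive_im_sum_s al be s t :
  summable al -> summable be -> s < 0 ->
  is_derive (fun s => im_sum al be s t) s (im_sum (kmul al) (kmul be) s t).
Proof.
intros Ha Hb Hs. unfold im_sum.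
erewrite (re_sum_ext (kmul be)); [apply is_derive_re_sum_s; eauto; now apply summable_nopp| reflexivity|].
intros k; unfold nopp, kmul; ring.
Qed.

Lemma is_derive_im_sum_t al be s t :
  summable al -> summable be -> s < 0 ->
  is_derive (fun t => im_sum al be s t) t (re_sum (kmul al) (kmul be) s t).
Proof.
intros Ha Hb Hs. unfold im_sum.
erewrite re_sum_ext; [apply is_derive_re_sum_t; eauto; now apply summable_nopp| |reflexivity].
intros k; unfold nopp, kmul; ring.
Qed.

Lemma re_sum_period al be s t : re_sum al be s (t + 2 * PI) = re_sum al be s t.
Proof.
unfold re_sum. apply Series_ext. intros k. unfold term.
replace (INR k * (t + 2 * PI)) with (INR k * t + 2 * INR k * PI) by ring.
now rewrite cos_period, sin_period.
Qed.

Lemma exp_le x y : x <= y -> exp x <= exp y.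
Proof. intros [H|<-]; [left; now apply exp_increasing|lra]. Qed.

(** Comparison with the circle [s = -1]: in [k s = - k + k (s + 1)] the second part is at most
    [n (s + 1)] for [k >= n], because [s + 1 <= 0]. The result is decay of order [|z|^n] at the
    centre. *)
Lemma re_sum_bound al be n s t :
  summable al -> summable be -> (forall k, (k < n)%nat -> al k = 0 /\ be k = 0) -> s <= -1 ->
  Rabs (re_sum al be s t) <=
    Series (fun k => (Rabs (al k) + Rabs (be k)) * exp (INR k * -1)) * exp (INR n * (s + 1)).
Proof.
intros Ha Hb Hn Hs.
assert (Hex := summable_plus al be Ha Hb (-1) ltac:(lra)).
rewrite <- Series_scal_r. unfold re_sum.
assert (Hle : forall k, Rabs (term al be s t k) <=
  (Rabs (al k) + Rabs (be k)) * exp (INR k * -1) * exp (INR n * (s + 1))).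
{ intros k. apply Rle_trans with (1 := term_bound _ _ _ _ _).
  rewrite Rmult_assoc, <- exp_plus.
  destruct (Nat.lt_ge_cases k n) as [Hk|Hk].
  - destruct (Hn k Hk) as [-> ->]. rewrite Rabs_R0. lra.
  - apply Rmult_le_compat_l; [apply Rplus_le_le_0_compat; apply Rabs_pos|].
    apply exp_le. apply le_INR in Hk. nra. }
apply Rle_trans with (Series (fun k => Rabs (term al be s t k))).
- apply Series_Rabs.
  apply (ex_series_le (V := R_CompleteNormedModule)) with (2 := ex_series_Rmult_r (exp (INR n * (s + 1))) _ Hex).
  intros k. unfold norm; simpl. unfold abs; simpl. rewrite Rabs_Rabsolu. apply Hle.
- apply Series_le; [|now apply ex_series_Rmult_r].
  intros k. split; [apply Rabs_pos|apply Hle].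
Qed.

Lemma re_sum_bound_le al be L s t :
  summable al -> summable be -> s <= L -> L < 0 ->
  Rabs (re_sum al be s t) <= Series (fun k => (Rabs (al k) + Rabs (be k)) * exp (INR k * L)).
Proof.
intros Ha Hb Hs HL.
assert (Hex := summable_plus al be Ha Hb L HL). unfold re_sum.
assert (Hle : forall k, Rabs (term al be s t k) <= (Rabs (al k) + Rabs (be k)) * exp (INR k * L)).
{ intros k. apply Rle_trans with (1 := term_bound _ _ _ _ _).
  apply Rmult_le_compat_l; [apply Rplus_le_le_0_compat; apply Rabs_pos|].
  apply exp_le. pose proof (pos_INR k). nra. }
apply Rle_trans with (Series (fun k => Rabs (term al be s t k))).
- apply Series_Rabs.
  apply (ex_series_le (V := R_CompleteNormedModule)) with (2 := Hex).
  intros k. unfold norm; simpl. unfold abs; simpl. rewrite Rabs_Rabsolu. apply Hle.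
- apply Series_le; [|exact Hex].
  intros k. split; [apply Rabs_pos|apply Hle].
Qed.

Lemma lipschitz (f f1 : R -> R) (D x y : R) :
  (forall t, Rmin x y <= t <= Rmax x y -> is_derive f t (f1 t)) ->
  (forall t, Rmin x y <= t <= Rmax x y -> Rabs (f1 t) <= D) ->
  Rabs (f y - f x) <= D * Rabs (y - x).
Proof.
intros H1 HD.
destruct (MVT_gen f x y f1) as [c [Hc E]].
{ intros; apply H1; lra. }
{ intros t Ht. apply continuity_pt_filterlim, (ex_derive_continuous (K := R_AbsRing) (V := R_NormedModule)).
  eexists; now apply H1. }
rewrite E, Rabs_mult. apply Rmult_le_compat_r; [apply Rabs_pos|now apply HD].
Qed.

(** Both partial derivatives are bounded on the half-plane [s' <= s / 2]; moving first in [t] and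
    then in [s] gives a Lipschitz estimate. *)
Lemma re_sum_continuous al be s t :
  summable al -> summable be -> s < 0 ->
  continuous (fun p : R * R => re_sum al be (fst p) (snd p)) (s, t).
Proof.
intros Ha Hb Hs.
set (D1 := Series (fun k => (Rabs (kmul al k) + Rabs (kmul be k)) * exp (INR k * (s / 2)))).
set (D2 := Series (fun k => (Rabs (nopp (kmul be) k) + Rabs (kmul al k)) * exp (INR k * (s / 2)))).
assert (B1 : forall s' t', s' <= s / 2 -> Rabs (re_sum (kmul al) (kmul be) s' t') <= D1).
{ intros. apply re_sum_bound_le; try lra; now apply summable_kmul. }
assert (B2 : forall s' t', s' <= s / 2 -> Rabs (re_sum (nopp (kmul be)) (kmul al) s' t') <= D2).
{ intros. apply re_sum_bound_le; try lra; [apply summable_nopp|]; now apply summable_kmul. }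
assert (P1 : 0 <= D1) by (apply Rle_trans with (2 := B1 s t ltac:(lra)), Rabs_pos).
assert (P2 : 0 <= D2) by (apply Rle_trans with (2 := B2 s t ltac:(lra)), Rabs_pos).
apply filterlim_locally. intros eps.
assert (Hd : 0 < Rmin (- s / 2) (eps / (D1 + D2 + 1))).
{ apply Rmin_pos; [lra|]. apply Rdiv_lt_0_compat; [apply cond_pos|lra]. }
exists (mkposreal _ Hd). intros [s' t'] [H1 H2]. simpl in H1, H2.
unfold ball in H1, H2; simpl in H1, H2. unfold AbsRing_ball, abs, minus, plus, opp in H1, H2; simpl in H1, H2.
change (Rabs (s' - s) < Rmin (- s / 2) (eps / (D1 + D2 + 1))) in H1.
change (Rabs (t' - t) < Rmin (- s / 2) (eps / (D1 + D2 + 1))) in H2.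
assert (H1a : Rabs (s' - s) < - s / 2) by (apply Rlt_le_trans with (1 := H1), Rmin_l).
assert (H1b : Rabs (s' - s) < eps / (D1 + D2 + 1)) by (apply Rlt_le_trans with (1 := H1), Rmin_r).
assert (H2b : Rabs (t' - t) < eps / (D1 + D2 + 1)) by (apply Rlt_le_trans with (1 := H2), Rmin_r).
apply Rabs_def2 in H1a.
change (Rabs (re_sum al be s' t' - re_sum al be s t) < eps).
assert (L1 : Rabs (re_sum al be s' t' - re_sum al be s t') <= D1 * Rabs (s' - s)).
{ assert (Hm : Rmax s s' <= s / 2) by (apply Rmax_lub; lra).
  apply (lipschitz (fun s => re_sum al be s t') (fun s => re_sum (kmul al) (kmul be) s t')); intros y Hy.
  - apply is_derive_re_sum_s; auto. lra.
  - apply B1. lra. }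
assert (L2 : Rabs (re_sum al be s t' - re_sum al be s t) <= D2 * Rabs (t' - t)).
{ apply (lipschitz (fun t => re_sum al be s t) (fun t => re_sum (nopp (kmul be)) (kmul al) s t)); intros y Hy.
  - apply is_derive_re_sum_t; auto.
  - apply B2. lra. }
replace (re_sum al be s' t' - re_sum al be s t) with
  ((re_sum al be s' t' - re_sum al be s t') + (re_sum al be s t' - re_sum al be s t)) by ring.
apply Rle_lt_trans with (1 := Rabs_triang _ _).
assert (E : eps = (D1 + D2 + 1) * (eps / (D1 + D2 + 1)) :> R) by (field; lra).
set (q := eps / (D1 + D2 + 1)) in *.
assert (0 <= Rabs (s' - s)) by apply Rabs_pos.
assert (D1 * Rabs (s' - s) <= D1 * q) by (apply Rmult_le_compat_l; lra).
assert (D2 * Rabs (t' - t) <= D2 * q) by (apply Rmult_le_compat_l; lra).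
lra.
Qed.

Lemma exp_small (c e : R) : 0 < c -> 0 < e -> exists s0, forall s, s <= s0 -> exp (c * s) <= e.
Proof.
intros Hc He. exists (ln e / c). intros s Hs.
rewrite <- (exp_ln e) by assumption. apply exp_le.
apply Rmult_le_compat_l with (r := c) in Hs; [|lra].
replace (c * (ln e / c)) with (ln e) in Hs by (field; lra). exact Hs.
Qed.

Lemma re_sum_split al be s t :
  summable al -> summable be -> s < 0 ->
  re_sum al be s t = al 0%nat + re_sum (fun k => if k then 0 else al k) (fun k => if k then 0 else be k) s t.
Proof.
intros Ha Hb Hs.
set (al' := fun k : nat => if k then 0 else al k). set (be' := fun k : nat => if k then 0 else be k).
assert (Ha' : summable al') by now apply summable_tail.
assert (Hb' : summable be') by now apply summable_tail.
unfold re_sum. rewrite (Series_incr_1 (term al be s t)), (Series_incr_1 (term al' be' s t)) by now apply ex_series_term.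
replace (term al be s t 0) with (al 0%nat).
2: { unfold term. simpl. rewrite !Rmult_0_l, exp_0, cos_0, sin_0. ring. }
replace (term al' be' s t 0) with 0.
2: { unfold term, al', be'. ring. }
rewrite Rplus_0_l. f_equal.
Qed.

(** The square of [|z g'(z)|], the modulus of the derivative of [g] with respect to [s + i t]. *)
Definition density (al be : nat -> R) (s t : R) : R :=
  re_sum (kmul al) (kmul be) s t ^ 2 + im_sum (kmul al) (kmul be) s t ^ 2.

(** Near the centre [density] is of order [exp (2 n s)], [sinh2] at most [exp (- 2 a s)], and [Re g]
    at least half of its value at the centre. The product on the left decays like
    [exp (2 (n - a) s)], which is where [a < n] enters. The threshold [s0] serves all [L] and
    [t]. *)
Lemma left_edge al be n a :
  summable al -> summable be -> (0 < n)%nat ->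
  (forall k, (0 < k < n)%nat -> al k = 0 /\ be k = 0) -> 0 < al 0%nat ->
  0 < a < INR n ->
  exists s0, forall s L t, s <= s0 -> s <= L -> L < 0 ->
    density al be s t * sinh2 a L s <= a ^ 2 * re_sum al be s t ^ 2.
Proof.
intros Ha Hb Hn Hz H0 Han.
set (C1 := Series (fun k => (Rabs (kmul al k) + Rabs (kmul be k)) * exp (INR k * -1))).
set (C2 := Series (fun k => (Rabs (kmul be k) + Rabs (nopp (kmul al) k)) * exp (INR k * -1))).
set (al' := fun k : nat => if k then 0 else al k). set (be' := fun k : nat => if k then 0 else be k).
set (C3 := Series (fun k => (Rabs (al' k) + Rabs (be' k)) * exp (INR k * -1))).
assert (Z1 : forall k, (k < n)%nat -> kmul al k = 0 /\ kmul be k = 0).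
{ intros [|k] Hk; unfold kmul; [simpl; split; ring|].
  destruct (Hz (S k) ltac:(lia)) as [-> ->]; split; ring. }
assert (Z2 : forall k, (k < n)%nat -> kmul be k = 0 /\ nopp (kmul al) k = 0).
{ intros k Hk. destruct (Z1 k Hk) as [E1 E2]. unfold nopp. rewrite E1, E2. split; ring. }
assert (Z3 : forall k, (k < 1)%nat -> al' k = 0 /\ be' k = 0).
{ intros [|k] Hk; [now split|lia]. }
set (c := al 0%nat) in *.
set (K := (C1 ^ 2 + C2 ^ 2) * exp (2 * INR n)).
assert (HK : 0 <= K).
{ unfold K. apply Rmult_le_pos; [nra|left; apply exp_pos]. }
assert (Hc3 : 0 <= C3 * exp 1).
{ apply Rle_trans with (Rabs (re_sum al' be' (-1) 0) * exp 1).
  { apply Rmult_le_pos; [apply Rabs_pos|left; apply exp_pos]. }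
  apply Rmult_le_compat_r; [left; apply exp_pos|].
  apply Rle_trans with (1 := re_sum_bound al' be' 1 (-1) 0 (summable_tail _ Ha) (summable_tail _ Hb) Z3 ltac:(lra)).
  fold C3. replace (INR 1 * (-1 + 1)) with 0 by (simpl; ring). rewrite exp_0. lra. }
(* Left of [s1] the decaying product is at most [a^2 (c / 2)^2]; left of [s2] the non-constant part
   of [Re g] is at most [c / 2]. The added 1 in the denominators guards against zero constants. *)
destruct (exp_small (2 * (INR n - a)) (a ^ 2 * (c / 2) ^ 2 / (K + 1))) as [s1 Hs1].
{ lra. }
{ apply Rdiv_lt_0_compat; [|lra]. apply Rmult_lt_0_compat; apply pow_lt; lra. }
destruct (exp_small 1 (c / 2 / (C3 * exp 1 + 1))) as [s2 Hs2].
{ lra. }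
{ apply Rdiv_lt_0_compat; lra. }
exists (Rmin (-1) (Rmin s1 s2)). intros s L t Hs HsL HL.
assert (Hs' : s <= -1) by (apply Rle_trans with (1 := Hs), Rmin_l).
assert (Hss : s <= Rmin s1 s2) by (apply Rle_trans with (1 := Hs), Rmin_r).
specialize (Hs1 s ltac:(apply Rle_trans with (1 := Hss), Rmin_l)).
specialize (Hs2 s ltac:(apply Rle_trans with (1 := Hss), Rmin_r)).
assert (B1 := re_sum_bound (kmul al) (kmul be) n s t (summable_kmul _ Ha) (summable_kmul _ Hb) Z1 Hs').
assert (B2 := re_sum_bound (kmul be) (nopp (kmul al)) n s t (summable_kmul _ Hb)
   (summable_nopp _ (summable_kmul _ Ha)) Z2 Hs').
assert (B3 := re_sum_bound al' be' 1 s t (summable_tail _ Ha) (summable_tail _ Hb) Z3 Hs').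
fold C1 in B1. fold C2 in B2. fold C3 in B3. fold (im_sum (kmul al) (kmul be) s t) in B2.
assert (HP : c / 2 <= re_sum al be s t).
{ rewrite re_sum_split by (auto; lra). fold al' be' c.
  assert (Rabs (re_sum al' be' s t) <= c / 2).
  { apply Rle_trans with (1 := B3).
    replace (INR 1 * (s + 1)) with (1 + 1 * s) by (simpl; ring).
    rewrite exp_plus, <- Rmult_assoc.
    apply Rle_trans with (C3 * exp 1 * (c / 2 / (C3 * exp 1 + 1))).
    { apply Rmult_le_compat_l; assumption. }
    apply Rmult_le_reg_r with (C3 * exp 1 + 1); [lra|].
    replace (C3 * exp 1 * (c / 2 / (C3 * exp 1 + 1)) * (C3 * exp 1 + 1)) with (C3 * exp 1 * (c / 2)) by (field; lra).
    nra. }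
  apply Rabs_le_between in H. lra. }
assert (HQ : density al be s t <= K * exp (2 * INR n * s)).
{ unfold density, K. rewrite Rmult_assoc, <- exp_plus.
  replace (2 * INR n + 2 * INR n * s) with (INR n * (s + 1) + INR n * (s + 1)) by ring.
  rewrite exp_plus. set (E := exp (INR n * (s + 1))) in *.
  rewrite <- (pow2_abs (re_sum _ _ _ _)), <- (pow2_abs (im_sum _ _ _ _)).
  pose proof (Rabs_pos (re_sum (kmul al) (kmul be) s t)).
  pose proof (Rabs_pos (im_sum (kmul al) (kmul be) s t)).
  assert (Rabs (re_sum (kmul al) (kmul be) s t) ^ 2 <= (C1 * E) ^ 2) by (apply pow_incr; lra).
  assert (Rabs (im_sum (kmul al) (kmul be) s t) ^ 2 <= (C2 * E) ^ 2) by (apply pow_incr; lra).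
  lra. }
assert (HS := sinh2_le_exp a L s ltac:(lra) HL HsL).
assert (HQ0 : 0 <= density al be s t) by (unfold density; nra).
apply Rle_trans with (K * exp (2 * INR n * s) * exp (- 2 * a * s)).
{ apply Rle_trans with (density al be s t * exp (- 2 * a * s)).
  - apply Rmult_le_compat_l; assumption.
  - apply Rmult_le_compat_r; [left; apply exp_pos|assumption]. }
rewrite Rmult_assoc, <- exp_plus.
replace (2 * INR n * s + - 2 * a * s) with (2 * (INR n - a) * s) by ring.
apply Rle_trans with (a ^ 2 * (c / 2) ^ 2).
- apply Rle_trans with (K * (a ^ 2 * (c / 2) ^ 2 / (K + 1))).
  { apply Rmult_le_compat_l; assumption. }
  apply Rmult_le_reg_r with (K + 1); [lra|].
  replace (K * (a ^ 2 * (c / 2) ^ 2 / (K + 1)) * (K + 1)) with (K * (a ^ 2 * (c / 2) ^ 2)) by (field; lra).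
  assert (0 <= a ^ 2 * (c / 2) ^ 2) by (apply Rmult_le_pos; apply pow2_ge_0). lra.
- apply Rmult_le_compat_l; [apply pow2_ge_0|]. apply pow_incr. lra.
Qed.

Lemma density_continuous al be a L s t :
  summable al -> summable be -> s < 0 -> re_sum al be s t <> 0 ->
  continuous (fun p : R * R => density al be (fst p) (snd p) * sinh2 a L (fst p)
     / re_sum al be (fst p) (snd p) ^ 2) (s, t).
Proof.
intros Ha Hb Hs HX. unfold density, im_sum, Rdiv.
assert (Hsq : forall f : R * R -> R, continuous f (s, t) -> continuous (fun p => f p ^ 2) (s, t)).
{ intros f Hf. apply (continuous_comp f (fun x => x ^ 2)); [exact Hf|].
  apply (ex_derive_continuous (K := R_AbsRing) (V := R_NormedModule)). auto_derive. exact I. }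
apply (continuous_mult (K := R_AbsRing)).
- apply (continuous_mult (K := R_AbsRing)).
  + apply (continuous_plus (V := R_NormedModule)); apply Hsq, re_sum_continuous; auto; repeat first [now apply summable_kmul|apply summable_nopp].
  + apply (continuous_comp fst (sinh2 a L)); [apply continuous_fst|].
    apply (ex_derive_continuous (K := R_AbsRing) (V := R_NormedModule)).
    eexists; apply is_derive_sinh2.
- apply (continuous_comp (fun p : R * R => re_sum al be (fst p) (snd p) ^ 2) Rinv).
  + apply Hsq, re_sum_continuous; auto.
  + apply (ex_derive_continuous (K := R_AbsRing) (V := R_NormedModule)). simpl. auto_derive.
    now apply (pow_nonzero _ 2).
Qed.

(** Ahlfors' method: at an interior maximum of the quotient of the metric
    [|g'| / Re g] by the comparison metric [a / sinh (a (L - s))], the two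
    curvatures give the bound; taking [a < n] makes the quotient vanish at the
    centre [s = -oo] of the disc. *)
Lemma ahlfors al be n a L s t :
  summable al -> summable be -> (0 < n)%nat ->
  (forall k, (0 < k < n)%nat -> al k = 0 /\ be k = 0) -> 0 < al 0%nat ->
  (forall s t, s < 0 -> 0 < re_sum al be s t) ->
  0 < a < INR n -> s < L -> L < 0 ->
  density al be s t * sinh2 a L s <= a ^ 2 * re_sum al be s t ^ 2.
Proof.
intros Ha Hb Hn Hz H0 HP Han HsL HL.
destruct (left_edge al be n a Ha Hb Hn Hz H0 Han) as [s0 Hs0].
apply Rnot_lt_le. intros Hbad.
set (s1 := Rmin s0 s).
assert (Hs1 : s1 <= s) by apply Rmin_r.
assert (Hs1' : s1 <= s0) by apply Rmin_l.
set (W := fun s t => density al be s t * sinh2 a L s / re_sum al be s t ^ 2).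
pose proof PI_RGT_0 as Hpi.
destruct (rectangle_max W s1 L t (t + 2 * PI)) as (x & y & Hx & Hy & Hmax); try lra.
{ intros x y Hx Hy. apply density_continuous; auto; try lra.
  apply Rgt_not_eq, HP. lra. }
assert (HX2 : forall x y, x < 0 -> 0 < re_sum al be x y ^ 2) by (intros; apply pow_lt, HP; lra).
assert (EW : forall x y, x < 0 -> W x y * re_sum al be x y ^ 2 = density al be x y * sinh2 a L x).
{ intros u v Hu. unfold W. field. apply Rgt_not_eq, HP, Hu. }
set (M := W x y) in *.
assert (HM : a ^ 2 < M).
{ apply Rlt_le_trans with (2 := Hmax s t ltac:(lra) ltac:(lra)).
  apply Rmult_lt_reg_r with (re_sum al be s t ^ 2); [apply HX2; lra|].
  rewrite EW by lra. exact Hbad. }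
assert (HM0 : 0 < M) by (pose proof (pow2_ge_0 a); lra).
(* Not on the right edge: [sinh2 a L] vanishes at [L], whereas [M > 0]. *)
assert (HxL : x < L).
{ destruct (Req_dec x L) as [E|]; [|lra]. exfalso.
  assert (E2 := EW x y ltac:(lra)). fold M in E2.
  assert (E3 : sinh2 a L x = 0) by (rewrite E; apply sinh2_diag).
  rewrite E3, Rmult_0_r in E2.
  assert (0 < M * re_sum al be x y ^ 2) by (apply Rmult_lt_0_compat; [|apply HX2]; lra).
  lra. }
(* Not on the left edge: there [left_edge] bounds the quotient by [a^2 < M]. *)
assert (Hxs : s1 < x).
{ destruct (Req_dec x s1) as [E|]; [|lra]. exfalso.
  assert (E2 := EW x y ltac:(lra)). fold M in E2.
  assert (E3 := Hs0 x L y ltac:(lra) ltac:(lra) HL).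
  rewrite <- E2 in E3.
  assert (HH := HX2 x y ltac:(lra)).
  apply Rmult_le_reg_r in E3; lra. }
(* The maximum may lie on the edge [t] or [t + 2 * PI]; by periodicity it still dominates its
   neighbours on both sides. *)
assert (Hall : forall v, Rabs (v - y) < 1 -> W x v <= M).
{ intros v Hv. apply Rabs_def2 in Hv.
  assert (Hper : forall v, W x (v + 2 * PI) = W x v).
  { intros u. unfold W, density, im_sum. now rewrite !re_sum_period. }
  assert (PI2 : 1 < 2 * PI) by (pose proof PI2_1; lra).
  destruct (Rlt_dec v t) as [H1|H1].
  - rewrite <- Hper. apply Hmax; lra.
  - destruct (Rlt_dec (t + 2 * PI) v) as [H2|H2].
    + replace v with (v - 2 * PI + 2 * PI) by ring. rewrite Hper. apply Hmax; lra.
    + apply Hmax; lra. }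
assert (EM := EW x y ltac:(lra)). fold M in EM.
assert (HQS : 0 < density al be x y * sinh2 a L x).
{ rewrite <- EM. apply Rmult_lt_0_compat; [lra|apply HX2; lra]. }
assert (HS := sinh2_pos a L x ltac:(lra) HxL).
assert (HQ : 0 < density al be x y) by nra.
assert (Hneg : forall u, Rabs (u - x) < Rmin (x - s1) (L - x) -> s1 <= u <= L).
{ intros u Hu. pose proof (Rmin_l (x - s1) (L - x)). pose proof (Rmin_r (x - s1) (L - x)).
  apply Rabs_def2 in Hu. lra. }
set (al1 := kmul al). set (be1 := kmul be).
set (al2 := kmul al1). set (be2 := kmul be1).
set (al3 := kmul al2). set (be3 := kmul be2).
assert (Ha1 : summable al1) by now apply summable_kmul.
assert (Hb1 : summable be1) by now apply summable_kmul.
assert (Ha2 : summable al2) by now apply summable_kmul.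
assert (Hb2 : summable be2) by now apply summable_kmul.
assert (HK : forall u v, u < 0 -> W u v <= M ->
  0 <= M * re_sum al be u v ^ 2 - (re_sum al1 be1 u v ^ 2 + im_sum al1 be1 u v ^ 2) * sinh2 a L u).
{ intros u v Hu HW. change (re_sum al1 be1 u v ^ 2 + im_sum al1 be1 u v ^ 2) with (density al be u v).
  rewrite <- EW by assumption. assert (HH := HX2 u v Hu). nra. }
destruct (functional_min (fun u => re_sum al be u y) (fun u => re_sum al1 be1 u y)
   (fun u => re_sum al1 be1 u y) (fun u => re_sum al2 be2 u y)
   (fun u => im_sum al1 be1 u y) (fun u => im_sum al2 be2 u y)
   (sinh2 a L) (sinh2_d a L) x (re_sum al2 be2 x y) (re_sum al3 be3 x y) (im_sum al3 be3 x y) (sinh2_dd a L x) M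
   (Rmin (x - s1) (L - x))) as [C1 C2].
{ apply Rmin_pos; lra. }
{ intros u Hu. apply Hneg in Hu. apply is_derive_re_sum_s; auto; lra. }
{ apply is_derive_re_sum_s; auto; lra. }
{ intros u Hu. apply Hneg in Hu. apply is_derive_re_sum_s; auto; lra. }
{ apply is_derive_re_sum_s; auto; lra. }
{ intros u Hu. apply Hneg in Hu. apply is_derive_im_sum_s; auto; lra. }
{ apply is_derive_im_sum_s; auto; lra. }
{ intros; apply is_derive_sinh2. }
{ apply is_derive_sinh2_d. }
{ intros u Hu. apply Hneg in Hu. apply HK; [lra|]. apply Hmax; lra. }
{ exact EM. }
(* The same in the direction of [t]: the derivatives come from the Cauchy-Riemann relations, and
   [sinh2] is constant. *)
destruct (functional_min (fun v => re_sum al be x v) (fun v => - im_sum al1 be1 x v)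
   (fun v => re_sum al1 be1 x v) (fun v => - im_sum al2 be2 x v)
   (fun v => im_sum al1 be1 x v) (fun v => re_sum al2 be2 x v)
   (fun _ => sinh2 a L x) (fun _ => 0) y (- re_sum al2 be2 x y) (- re_sum al3 be3 x y) (- im_sum al3 be3 x y) 0 M
   1) as [C3 C4].
{ lra. }
{ intros v Hv. apply is_derive_re_sum_t'; auto; lra. }
{ apply (is_derive_opp (fun v => im_sum al1 be1 x v)). apply is_derive_im_sum_t; auto; lra. }
{ intros v Hv. apply is_derive_re_sum_t'; auto; lra. }
{ apply (is_derive_opp (fun v => im_sum al2 be2 x v)). apply is_derive_im_sum_t; auto; lra. }
{ intros v Hv. apply is_derive_im_sum_t; auto; lra. }
{ apply is_derive_re_sum_t'; auto; lra. }
{ intros. apply (is_derive_const (V := R_NormedModule)). }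
{ apply (is_derive_const (V := R_NormedModule)). }
{ intros v Hv. apply HK; [lra|]. now apply Hall. }
{ exact EM. }
assert (M <= a ^ 2).
{ eapply (curvature_algebra a M (re_sum al be x y) (re_sum al1 be1 x y) (im_sum al1 be1 x y)
    (re_sum al2 be2 x y) (im_sum al2 be2 x y) (re_sum al3 be3 x y) (im_sum al3 be3 x y) (sinh2 a L x)
    (sinh2_d a L x) (sinh2_dd a L x)).
  - exact HS.
  - exact HQ.
  - exact EM.
  - apply sinh2_curvature.
  - exact C1.
  - exact C3.
  - exact C2.
  - exact C4. }
lra.
Qed.

(** Both perturbations are removed along one parameter, [a = n - e] and [L = - e]: the difference of
    the two sides is continuous in [e], so it cannot be negative at [e = 0]. *)
Lemma derivative_bound al be n s t :
  summable al -> summable be -> (0 < n)%nat ->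
  (forall k, (0 < k < n)%nat -> al k = 0 /\ be k = 0) -> 0 < al 0%nat ->
  (forall s t, s < 0 -> 0 < re_sum al be s t) -> s < 0 ->
  density al be s t * sinh2 (INR n) 0 s <= INR n ^ 2 * re_sum al be s t ^ 2.
Proof.
intros Ha Hb Hn Hz H0 HP Hs.
assert (Hn0 : 0 < INR n) by now apply lt_0_INR.
set (F := fun e => (INR n - e) ^ 2 * re_sum al be s t ^ 2 - density al be s t * sinh2 (INR n - e) (- e) s).
assert (HF : forall e, 0 < e -> e < INR n -> e < - s -> 0 <= F e).
{ intros e H1 H2 H3. unfold F.
  assert (HH := ahlfors al be n (INR n - e) (- e) s t Ha Hb Hn Hz H0 HP ltac:(lra) ltac:(lra) ltac:(lra)). lra. }
assert (HF0 : 0 <= F 0).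
{ apply Rnot_lt_le. intros Hlt.
  assert (Hc : continuous F 0).
  { apply (ex_derive_continuous (K := R_AbsRing) (V := R_NormedModule)).
    unfold F, sinh2. auto_derive. exact I. }
  apply filterlim_locally with (eps := mkposreal (- F 0) ltac:(lra)) in Hc.
  destruct Hc as [d Hd].
  set (e := Rmin (d / 2) (Rmin (INR n / 2) (- s / 2))).
  assert (He0 : 0 < e).
  { unfold e. destruct d as [d Hd']; simpl. repeat apply Rmin_pos; lra. }
  assert (He1 : e <= d / 2) by apply Rmin_l.
  assert (He' : e <= Rmin (INR n / 2) (- s / 2)) by apply Rmin_r.
  assert (He2 : e <= INR n / 2) by (apply Rle_trans with (1 := He'), Rmin_l).
  assert (He3 : e <= - s / 2) by (apply Rle_trans with (1 := He'), Rmin_r).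
  specialize (Hd e).
  assert (Hball : ball 0 d e).
  { change (Rabs (e - 0) < d). rewrite Rminus_0_r, Rabs_pos_eq by lra. destruct d; simpl in *; lra. }
  specialize (Hd Hball). change (Rabs (F e - F 0) < - F 0) in Hd.
  apply Rabs_def2 in Hd. specialize (HF e ltac:(lra) ltac:(lra) ltac:(lra)). lra. }
unfold F in HF0. rewrite Rminus_0_r, Ropp_0 in HF0. lra.
Qed.

(** With [x = |z|^n], [sinh2 n 0 s] is [((1 - x^2) / (2 x))^2]. *)
Lemma real_part_bound al be n s t tau :
  summable al -> summable be -> (0 < n)%nat ->
  (forall k, (0 < k < n)%nat -> al k = 0 /\ be k = 0) -> 0 < al 0%nat ->
  (forall s t, s < 0 -> 0 < re_sum al be s t) -> s < 0 -> 0 < tau ->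
  2 * tau * INR n * exp (INR n * s) < 1 - exp (INR n * s) ^ 2 ->
  0 < re_sum al be s t + tau * re_sum (kmul al) (kmul be) s t.
Proof.
intros Ha Hb Hn Hz H0 HP Hs Ht Hx.
assert (HB := derivative_bound al be n s t Ha Hb Hn Hz H0 HP Hs).
assert (Hn0 : 0 < INR n) by now apply lt_0_INR.
assert (HP0 := HP s t Hs).
set (P := re_sum al be s t) in *. set (U := re_sum (kmul al) (kmul be) s t) in *.
set (x := exp (INR n * s)) in *.
assert (Hx0 : 0 < x) by apply exp_pos.
set (S := (1 - x ^ 2) / (2 * x)).
assert (HS : tau * INR n < S).
{ unfold S. apply Rmult_lt_reg_r with (2 * x); [lra|].
  replace ((1 - x ^ 2) / (2 * x) * (2 * x)) with (1 - x ^ 2) by (field; lra). lra. }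
assert (ES : sinh2 (INR n) 0 s = S ^ 2).
{ unfold sinh2, S.
  replace (- (2 * INR n * (0 - s))) with (INR n * s + INR n * s) by ring.
  replace (2 * INR n * (0 - s)) with (- (INR n * s + INR n * s)) by ring.
  rewrite exp_Ropp, exp_plus. fold x. field. lra. }
rewrite ES in HB.
assert (HU : U ^ 2 * S ^ 2 <= INR n ^ 2 * P ^ 2).
{ apply Rle_trans with (2 := HB). apply Rmult_le_compat_r; [apply pow2_ge_0|].
  unfold density. fold U. pose proof (pow2_ge_0 (im_sum (kmul al) (kmul be) s t)). lra. }
assert (Hnt : 0 < tau * INR n) by now apply Rmult_lt_0_compat.
assert (Habs : Rabs (U * S) <= INR n * P).
{ rewrite <- (Rabs_pos_eq (INR n * P)) by nra. apply Rsqr_le_abs_0. unfold Rsqr. lra. }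
apply Rabs_le_between in Habs.
(* By [Habs], [S * (P + tau * U)] is at least [(S - tau * INR n) * P]. *)
apply Rmult_lt_reg_l with S; [lra|]. nra.
Qed.

(** * The operator on power series *)

Lemma sum_n_C (a : nat -> C) (N : nat) :
  @sum_n C_AbelianMonoid a N = (sum_n (fun k => Re (a k)) N, sum_n (fun k => Im (a k)) N).
Proof.
induction N as [|N IH].
- rewrite !sum_O. now destruct (a 0%nat).
- rewrite !sum_Sn, IH. reflexivity.
Qed.

Lemma is_series_C (a : nat -> C) (l : C) :
  @is_series C_AbsRing C_NormedModule a l <->
  is_series (fun k => Re (a k)) (Re l) /\ is_series (fun k => Im (a k)) (Im l).
Proof.
unfold is_series. split.
- intros H. split.
  + apply filterlim_ext with (fun N => Re (@sum_n C_AbelianMonoid a N)).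
    { intros N. now rewrite sum_n_C. }
    apply filterlim_comp with (1 := H). apply (continuous_fst (U := R_UniformSpace) (V := R_UniformSpace)).
  + apply filterlim_ext with (fun N => Im (@sum_n C_AbelianMonoid a N)).
    { intros N. now rewrite sum_n_C. }
    apply filterlim_comp with (1 := H). apply (continuous_snd (U := R_UniformSpace) (V := R_UniformSpace)).
- intros [H1 H2].
  apply filterlim_ext with (fun N => (sum_n (fun k => Re (a k)) N, sum_n (fun k => Im (a k)) N)).
  { intros N. now rewrite sum_n_C. }
  apply (proj2 (filterlim_locally (U := C_UniformSpace) _ l)). intros eps.
  destruct (proj1 (filterlim_locally _ _) H1 eps) as [N1 HN1].
  destruct (proj1 (filterlim_locally _ _) H2 eps) as [N2 HN2].
  exists (Nat.max N1 N2). intros N HN. split; simpl; [apply HN1|apply HN2]; lia.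
Qed.

Lemma is_series_C_unique (a : nat -> C) (l l' : C) :
  @is_series C_AbsRing C_NormedModule a l -> @is_series C_AbsRing C_NormedModule a l' -> l = l'.
Proof.
intros H H'. apply is_series_C in H, H'.
destruct H as [H1 H2], H' as [H1' H2'].
apply injective_projections.
- change (Re l = Re l'). rewrite <- (is_series_unique _ _ H1). now apply is_series_unique.
- change (Im l = Im l'). rewrite <- (is_series_unique _ _ H2). now apply is_series_unique.
Qed.

(** [is_expansion] constrains only the coefficients from index [p + n] on. Zeroing the others gives
    series indexed from 0 and coefficients determined by [f]. *)
Definition trunc (N : nat) (a : nat -> C) (k : nat) : C := if (k <? N)%nat then RtoC 0 else a k.

Lemma trunc_lt N a k : (k < N)%nat -> trunc N a k = RtoC 0.
Proof. intros H. unfold trunc. now apply Nat.ltb_lt in H as ->. Qed.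

Lemma trunc_ge N a k : (N <= k)%nat -> trunc N a k = a k.
Proof. intros H. unfold trunc. now apply Nat.ltb_ge in H as ->. Qed.

Lemma sum_n_zero {G : AbelianMonoid} (b : nat -> G) N :
  (forall k, (k <= N)%nat -> b k = zero) -> sum_n b N = zero.
Proof.
intros H. induction N as [|N IH].
- rewrite sum_O. now apply H.
- rewrite sum_Sn, IH, H by (intros; try apply H; lia). apply plus_zero_l.
Qed.

Lemma is_series_shift (b : nat -> C) (N : nat) (l : C) :
  (forall k, (k < N)%nat -> b k = RtoC 0) ->
  @is_series C_AbsRing C_NormedModule (fun j => b (N + j)%nat) l <->
  @is_series C_AbsRing C_NormedModule b l.
Proof.
intros H. destruct N as [|N]; [reflexivity|].
assert (E : @sum_n C_AbelianMonoid b N = zero).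
{ apply (sum_n_zero (G := C_AbelianMonoid)). intros k Hk. apply H. lia. }
split; intros Hs.
- apply (is_series_decr_n b (S N) l); [lia|].
  simpl. match goal with |- is_series _ ?y => replace y with l; [exact Hs|] end.
  change (l = Cplus l (Copp (@sum_n C_AbelianMonoid b N))). rewrite E.
  change (l = Cplus l (Copp (RtoC 0))). ring.
- apply (is_series_incr_n b (S N) l); [lia|].
  simpl. match goal with |- is_series _ ?y => replace y with l; [exact Hs|] end.
  change (l = Cplus l (@sum_n C_AbelianMonoid b N)). rewrite E.
  change (l = Cplus l (RtoC 0)). ring.
Qed.

Lemma is_expansion_trunc p n a z v :
  is_expansion p n a z v <->
  @is_series C_AbsRing C_NormedModule (fun k => trunc (p + n) a k * z ^ k)%C (v - z ^ p)%C.
Proof.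
rewrite <- (is_series_shift _ (p + n)).
2: { intros k Hk. rewrite trunc_lt by assumption. ring. }
unfold is_expansion. split; apply is_series_ext; intros j; rewrite trunc_ge by lia; reflexivity.
Qed.

Lemma exp_INR_mul k s : exp (INR k * s) = exp s ^ k.
Proof.
induction k as [|k IH].
- simpl. now rewrite Rmult_0_l, exp_0.
- rewrite S_INR, Rmult_plus_distr_r, exp_plus, IH, Rmult_1_l. simpl. ring.
Qed.

(** Convergence at [x = exp (s / 2)] bounds the terms [al k * x^k], and [exp (k s) = x^k * x^k]
    leaves a geometric majorant. *)
Lemma summable_of_pseries (al : nat -> R) :
  (forall x, 0 < x < 1 -> ex_series (fun k => al k * x ^ k)) -> summable al.
Proof.
intros H s Hs.
set (x := exp (s / 2)).
assert (Hx : 0 < x < 1).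
{ split; [apply exp_pos|]. rewrite <- exp_0. apply exp_increasing. lra. }
assert (Hl := ex_series_lim_0 _ (H x Hx)).
destruct (filterlim_bounded (K := R_AbsRing) (V := R_NormedModule) (fun k => al k * x ^ k)) as [M HM].
{ exists 0. exact Hl. }
apply (ex_series_le (V := R_CompleteNormedModule)) with (fun k => M * x ^ k).
- intros k. unfold norm; simpl. unfold abs; simpl.
  rewrite Rabs_pos_eq by (apply Rmult_le_pos; [apply Rabs_pos|left; apply exp_pos]).
  assert (E : exp (INR k * s) = x ^ k * x ^ k).
  { unfold x. rewrite <- exp_INR_mul, <- exp_plus. f_equal. field. }
  rewrite E, <- Rmult_assoc. apply Rmult_le_compat_r; [apply pow_le; lra|].
  specialize (HM k). change (Rabs (al k * x ^ k) <= M) in HM.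
  rewrite Rabs_mult, (Rabs_pos_eq (x ^ k)) in HM by (apply pow_le; lra). exact HM.
- apply ex_series_Rmult_l. exists (/ (1 - x)). apply is_series_geom. rewrite Rabs_pos_eq; lra.
Qed.

Lemma summable_lin al de : summable al -> summable (fun k => (1 + INR k * de) * al k).
Proof.
intros Ha s Hs.
apply (ex_series_le (V := R_CompleteNormedModule)) with
  (fun k => Rabs (al k) * exp (INR k * s) + Rabs de * (Rabs (kmul al k) * exp (INR k * s))).
- intros k. unfold norm; simpl. unfold abs; simpl.
  rewrite Rabs_pos_eq by (apply Rmult_le_pos; [apply Rabs_pos|left; apply exp_pos]).
  rewrite <- Rmult_assoc, <- Rmult_plus_distr_r.
  apply Rmult_le_compat_r; [left; apply exp_pos|].
  unfold kmul. rewrite <- Rabs_mult.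
  replace ((1 + INR k * de) * al k) with (al k + de * (INR k * al k)) by ring.
  apply Rabs_triang.
- apply (ex_series_plus (V := R_NormedModule)); [now apply Ha|].
  apply ex_series_Rmult_l. now apply summable_kmul.
Qed.

(** A positive power of the multiplier is a repeated linear factor in [k], each harmless by
    [summable_lin]; for a negative one the factor is at most 1. *)
Lemma summable_powerRZ al de m :
  0 <= de -> summable al -> summable (fun k => powerRZ (1 + INR k * de) m * al k).
Proof.
intros Hd Ha.
assert (H1 : forall k, 1 <= 1 + INR k * de) by (intros k; pose proof (pos_INR k); nra).
destruct m as [|q|q]; simpl powerRZ.
- apply summable_le with (2 := Ha). intros k. rewrite Rmult_1_l. lra.
- induction (Pos.to_nat q) as [|N IH].
  + apply summable_le with (2 := Ha). intros k. simpl. rewrite Rmult_1_l. lra.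
  + apply summable_le with (2 := summable_lin _ de IH). intros k. simpl. right. f_equal. ring.
- apply summable_le with (2 := Ha). intros k. rewrite Rabs_mult.
  rewrite Rabs_inv.
  assert (1 <= Rabs ((1 + INR k * de) ^ Pos.to_nat q)).
  { rewrite Rabs_pos_eq; [apply pow_R1_Rle, H1|apply pow_le; specialize (H1 k); lra]. }
  assert (/ Rabs ((1 + INR k * de) ^ Pos.to_nat q) <= 1).
  { rewrite <- Rinv_1 at 2. apply Rinv_le_contravar; lra. }
  pose proof (Rabs_pos (al k)). nra.
Qed.

Lemma summable_shift p al : summable al -> summable (fun k => al (p + k)%nat).
Proof.
intros Ha s Hs.
apply ex_series_ext with (fun k => exp (- (INR p * s)) * (Rabs (al (p + k)%nat) * exp (INR (p + k) * s))).
- intros k. rewrite plus_INR.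
  assert (E : exp (INR k * s) = exp (- (INR p * s)) * exp ((INR p + INR k) * s)).
  { rewrite <- exp_plus. f_equal. ring. }
  rewrite E. match goal with |- ?x = ?y => change (x = y :> R) end. ring.
- apply ex_series_Rmult_l. apply (ex_series_incr_n (fun k => Rabs (al k) * exp (INR k * s))). now apply Ha.
Qed.

Definition polar (s t : R) : C := (exp s * cos t, exp s * sin t).

Lemma polar_pow s t k : (polar s t ^ k)%C = polar (INR k * s) (INR k * t).
Proof.
induction k as [|k IH].
- simpl. unfold polar. rewrite !Rmult_0_l, exp_0, cos_0, sin_0. unfold RtoC. f_equal; ring.
- change (polar s t ^ S k)%C with (polar s t * polar s t ^ k)%C. rewrite IH, S_INR.
  unfold polar, Cmult. simpl.
  rewrite !Rmult_plus_distr_r, !Rmult_1_l, exp_plus, cos_plus, sin_plus. f_equal; ring.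
Qed.

Lemma Cmod_polar s t : Cmod (polar s t) = exp s.
Proof.
unfold Cmod, polar. simpl.
replace (exp s * cos t * (exp s * cos t * 1) + exp s * sin t * (exp s * sin t * 1))
  with (exp s ^ 2 * ((sin t)² + (cos t)²)) by (unfold Rsqr; ring).
rewrite sin2_cos2, Rmult_1_r. apply sqrt_pow2. left; apply exp_pos.
Qed.

Lemma polar_in_U s t : s < 0 -> in_U (polar s t).
Proof.
intros Hs. unfold in_U. rewrite Cmod_polar, <- exp_0. now apply exp_increasing.
Qed.

Lemma polar_surj z : z <> RtoC 0 -> exists t, z = polar (ln (Cmod z)) t.
Proof.
intros Hz. assert (Hm : 0 < Cmod z) by now apply Cmod_gt_0.
unfold polar. rewrite exp_ln by assumption.
assert (E : (fst z / Cmod z) ^ 2 + (snd z / Cmod z) ^ 2 = 1).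
{ assert (E2 := Cmod2_alt z). unfold Re, Im in E2.
  replace ((fst z / Cmod z) ^ 2 + (snd z / Cmod z) ^ 2) with ((fst z ^ 2 + snd z ^ 2) / Cmod z ^ 2) by (field; lra).
  rewrite <- E2. field. lra. }
set (x := fst z / Cmod z) in *. set (y := snd z / Cmod z) in *.
assert (Hx : -1 <= x <= 1) by nra.
assert (Ez : forall u v, u = x -> v = y -> z = (Cmod z * u, Cmod z * v)).
{ intros u v -> ->. unfold x, y. destruct z as [z1 z2]. simpl. f_equal; field; lra. }
destruct (Rle_dec 0 y) as [Hy|Hy].
- exists (acos x). apply Ez; [now apply cos_acos|].
  rewrite sin_acos by assumption. rewrite <- (sqrt_pow2 y Hy). f_equal. unfold Rsqr. lra.
- exists (- acos x). apply Ez; [rewrite cos_neg; now apply cos_acos|].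
  rewrite sin_neg, sin_acos by assumption.
  rewrite <- (Ropp_involutive y). f_equal. rewrite <- (sqrt_pow2 (- y)) by lra. f_equal. unfold Rsqr. lra.
Qed.

Lemma is_series_polar (c : nat -> C) s t :
  summable (fun k => Re (c k)) -> summable (fun k => Im (c k)) -> s < 0 ->
  @is_series C_AbsRing C_NormedModule (fun k => c k * polar s t ^ k)%C
    (re_sum (fun k => Re (c k)) (fun k => Im (c k)) s t, im_sum (fun k => Re (c k)) (fun k => Im (c k)) s t).
Proof.
intros Ha Hb Hs. apply is_series_C. split.
- apply is_series_ext with (term (fun k => Re (c k)) (fun k => Im (c k)) s t).
  + intros k. rewrite polar_pow. unfold term, polar. rewrite re_mult. simpl. ring.
  + apply Series_correct. now apply ex_series_term.
- apply is_series_ext with (term (fun k => Im (c k)) (nopp (fun k => Re (c k))) s t).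
  + intros k. rewrite polar_pow. unfold term, polar, nopp, Cmult. simpl. unfold Re, Im. simpl. ring.
  + apply Series_correct. apply ex_series_term; auto. now apply summable_nopp.
Qed.

(** On the real segment of the disc the series splits into two real power series, in the real and in
    the imaginary parts of the coefficients. *)
Lemma expansion_summable p n a (f : C -> C) :
  (forall x, in_U x -> is_expansion p n a x (f x)) ->
  summable (fun k => Re (trunc (p + n) a k)) /\ summable (fun k => Im (trunc (p + n) a k)).
Proof.
intros H.
assert (HC : forall x, 0 < x < 1 ->
  ex_series (fun k => Re (trunc (p + n) a k) * x ^ k) /\ ex_series (fun k => Im (trunc (p + n) a k) * x ^ k)).
{ intros x Hx.
  assert (Hin : in_U (RtoC x)) by (unfold in_U; rewrite Cmod_R, Rabs_pos_eq; lra).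
  specialize (H _ Hin). rewrite is_expansion_trunc in H. apply is_series_C in H. destruct H as [H1 H2].
  split; eexists.
  - apply is_series_ext with (2 := H1). intros k. now rewrite <- RtoC_pow, re_scal_r.
  - apply is_series_ext with (2 := H2). intros k. now rewrite <- RtoC_pow, im_scal_r. }
split; apply summable_of_pseries; intros x Hx; now apply HC.
Qed.

Lemma pseries_coef_unique (al be : nat -> R) (F : R -> R) :
  (forall x, -1 < x < 1 -> is_series (fun k => al k * x ^ k) (F x)) ->
  (forall x, -1 < x < 1 -> is_series (fun k => be k * x ^ k) (F x)) ->
  forall k, al k = be k.
Proof.
intros Ha Hb k.
assert (HR : forall al, (forall x, -1 < x < 1 -> is_series (fun k => al k * x ^ k) (F x)) ->
   Rbar_lt 0 (CV_radius al)).
{ clear. intros al H.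
  apply Rbar_lt_le_trans with (1 / 2); [simpl; lra|].
  apply (proj1 (CV_radius_bounded al)).
  destruct (filterlim_bounded (K := R_AbsRing) (V := R_NormedModule) (fun k => al k * (1 / 2) ^ k)) as [M HM].
  { exists 0. apply (ex_series_lim_0 (fun k => al k * (1 / 2) ^ k)). eexists. apply H. lra. }
  exists M. exact HM. }
apply PSeries_ext_recip; [now apply HR|now apply HR|].
exists (mkposreal 1 Rlt_0_1). intros x Hx.
change (Rabs (x - 0) < 1) in Hx. rewrite Rminus_0_r in Hx. apply Rabs_def2 in Hx.
unfold PSeries. rewrite (is_series_unique _ _ (Ha x ltac:(lra))). symmetry.
apply is_series_unique. apply Hb. lra.
Qed.

Lemma expansion_unique p n a b (f : C -> C) :
  (forall x, in_U x -> is_expansion p n a x (f x)) ->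
  (forall x, in_U x -> is_expansion p n b x (f x)) ->
  forall k, (p + n <= k)%nat -> a k = b k.
Proof.
intros Ha Hb k Hk.
rewrite <- (trunc_ge (p + n) a k Hk), <- (trunc_ge (p + n) b k Hk).
assert (HC : forall a, (forall x, in_U x -> is_expansion p n a x (f x)) -> forall x, -1 < x < 1 ->
   is_series (fun k => Re (trunc (p + n) a k) * x ^ k) (Re (f (RtoC x) - RtoC x ^ p)%C) /\
   is_series (fun k => Im (trunc (p + n) a k) * x ^ k) (Im (f (RtoC x) - RtoC x ^ p)%C)).
{ clear. intros a H x Hx.
  assert (Hin : in_U (RtoC x)) by (unfold in_U; rewrite Cmod_R; apply Rabs_def1; lra).
  specialize (H _ Hin). rewrite is_expansion_trunc in H. apply is_series_C in H. destruct H as [H1 H2].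
  split.
  - apply is_series_ext with (2 := H1). intros k. now rewrite <- RtoC_pow, re_scal_r.
  - apply is_series_ext with (2 := H2). intros k. now rewrite <- RtoC_pow, im_scal_r. }
apply injective_projections.
- apply (pseries_coef_unique (fun k => Re (trunc (p + n) a k)) (fun k => Re (trunc (p + n) b k))
    (fun x => Re (f (RtoC x) - RtoC x ^ p)%C)); intros; now apply HC.
- apply (pseries_coef_unique (fun k => Im (trunc (p + n) a k)) (fun k => Im (trunc (p + n) b k))
    (fun x => Im (f (RtoC x) - RtoC x ^ p)%C)); intros; now apply HC.
Qed.

(** The description in [Theta] is definite because [f] determines its coefficients from [p + n] on,
    hence the sum of the modified series. The formulas for [Theta] below all rest on this. *)
Lemma Theta_unique p n m alpha beta a f z v :
  (forall x, in_U x -> is_expansion p n a x (f x)) ->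
  is_expansion p n
    (fun k => RtoC (powerRZ ((alpha + INR k * beta) / (alpha + INR p * beta)) m) * a k)%C z v ->
  Theta p n m alpha beta f z = v.
Proof.
intros Ha Hv. unfold Theta.
apply (iota_unique (V := C_CompleteNormedModule)); [|now exists a].
intros y (b & Hb & Hy).
assert (E : (y - z ^ p = v - z ^ p)%C).
{ apply is_series_C_unique with (1 := Hy).
  apply (is_series_ext (K := C_AbsRing) (V := C_NormedModule)) with (2 := Hv).
  intros j. now rewrite (expansion_unique p n a b f Ha Hb) by lia. }
apply (f_equal (fun u : C => u + z ^ p)%C) in E.
change (y = v :> C). replace (y : C) with (y - z ^ p + z ^ p)%C; [|unfold C_CompleteNormedModule; simpl; ring].
rewrite E. ring.
Qed.

(** The coefficients of [Theta f z / z^p - 1]. *)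
Definition coef (p n : nat) (m : Z) (alpha beta : R) (a : nat -> C) : nat -> C :=
  trunc n (fun k => RtoC (powerRZ ((alpha + INR (p + k) * beta) / (alpha + INR p * beta)) m)
                    * a (p + k)%nat)%C.

(** In this form, raising [m] by one multiplies the [k]-th coefficient of the quotient by [z^p] by
    [1 + k de], with [de = beta / (alpha + p beta)]: it applies [1 + de z d/dz]. *)
Lemma multiplier_eq p k alpha beta :
  0 < alpha + INR p * beta ->
  (alpha + INR (p + k) * beta) / (alpha + INR p * beta) = 1 + INR k * (beta / (alpha + INR p * beta)).
Proof. intros H. rewrite plus_INR. field. lra. Qed.

Lemma coef_eq p n m alpha beta a k :
  0 < alpha + INR p * beta ->
  coef p n m alpha beta a k =
  (RtoC (powerRZ (1 + INR k * (beta / (alpha + INR p * beta))) m) * trunc (p + n) a (p + k))%C.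
Proof.
intros H. unfold coef. destruct (Nat.lt_ge_cases k n) as [Hk|Hk].
- rewrite !trunc_lt by lia. ring.
- rewrite !trunc_ge by lia. now rewrite multiplier_eq.
Qed.

Lemma coef_summable p n m alpha beta a f :
  0 < beta -> 0 < alpha + INR p * beta ->
  (forall x, in_U x -> is_expansion p n a x (f x)) ->
  summable (fun k => Re (coef p n m alpha beta a k)) /\
  summable (fun k => Im (coef p n m alpha beta a k)).
Proof.
intros Hb H Ha. apply expansion_summable in Ha. destruct Ha as [H1 H2].
assert (Hd : 0 <= beta / (alpha + INR p * beta)) by (left; now apply Rdiv_lt_0_compat).
apply (summable_shift p) in H1. apply (summable_shift p) in H2.
apply (summable_powerRZ _ (beta / (alpha + INR p * beta)) m Hd) in H1.
apply (summable_powerRZ _ (beta / (alpha + INR p * beta)) m Hd) in H2.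
split.
- apply summable_le with (2 := H1). intros k. rewrite coef_eq, re_scal_l by assumption. lra.
- apply summable_le with (2 := H2). intros k. rewrite coef_eq, im_scal_l by assumption. lra.
Qed.

Lemma div_zpow_Theta p n m alpha beta a f s t :
  0 < beta -> 0 < alpha + INR p * beta ->
  (forall x, in_U x -> is_expansion p n a x (f x)) -> s < 0 ->
  div_zpow p (Theta p n m alpha beta f) (polar s t) =
  (1 + (re_sum (fun k => Re (coef p n m alpha beta a k)) (fun k => Im (coef p n m alpha beta a k)) s t,
        im_sum (fun k => Re (coef p n m alpha beta a k)) (fun k => Im (coef p n m alpha beta a k)) s t))%C.
Proof.
intros Hb H Ha Hs.
destruct (coef_summable p n m alpha beta a f Hb H Ha) as [H1 H2].
assert (HS := is_series_polar (coef p n m alpha beta a) s t H1 H2 Hs).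
set (S := (re_sum _ _ s t, im_sum _ _ s t)) in *.
assert (Hz : polar s t <> RtoC 0).
{ apply Cmod_gt_0. rewrite Cmod_polar. apply exp_pos. }
assert (E : Theta p n m alpha beta f (polar s t) = (polar s t ^ p * (1 + S))%C).
{ apply (Theta_unique _ _ _ _ _ a _ _ _ Ha). unfold is_expansion.
  replace (polar s t ^ p * (1 + S) - polar s t ^ p)%C with (polar s t ^ p * S)%C by ring.
  rewrite <- (is_series_shift _ n) in HS.
  2: { intros k Hk. unfold coef. rewrite trunc_lt by assumption. ring. }
  apply (is_series_scal (K := C_AbsRing) (V := C_NormedModule) (polar s t ^ p)%C) in HS.
  apply (is_series_ext (K := C_AbsRing) (V := C_NormedModule)) with (2 := HS).
  intros j. unfold coef. rewrite trunc_ge by lia.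
  change (polar s t ^ p * (RtoC (powerRZ ((alpha + INR (p + (n + j)) * beta) / (alpha + INR p * beta)) m)
     * a (p + (n + j))%nat * polar s t ^ (n + j)) =
    RtoC (powerRZ ((alpha + INR (p + n + j) * beta) / (alpha + INR p * beta)) m) * a (p + n + j)%nat
     * polar s t ^ (p + n + j))%C.
  rewrite Nat.add_assoc, <- (Nat.add_assoc p n j) at 1. rewrite <- !Nat.add_assoc.
  rewrite (Cpow_add_r (polar s t) p (n + j)). ring. }
unfold div_zpow. destruct (Ceq_dec (polar s t) (RtoC 0)) as [|_]; [contradiction|].
rewrite E. field. now apply Cpow_nz.
Qed.

(** * The half-plane, the radius and the lower bound inside it *)

Lemma Janowski_half_plane A B w :
  -1 <= B -> B < A -> A <= 1 -> Cmod w < 1 -> (1 - A) / (1 - B) < Re (Janowski A B w).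
Proof.
intros HB HBA HA Hw. unfold Janowski.
assert (Hq : fst w ^ 2 + snd w ^ 2 < 1).
{ assert (E := Cmod2_alt w). unfold Re, Im in E. rewrite <- E.
  pose proof (Cmod_ge_0 w). nra. }
destruct w as [x y]. simpl fst in Hq; simpl snd in Hq.
assert (Hx : -1 < x < 1) by nra.
set (D := (1 + B * x) ^ 2 + (B * y) ^ 2).
assert (HD : 0 < D).
{ unfold D. assert (0 < 1 + B * x) by nra. assert (0 < (1 + B * x) ^ 2) by (apply pow_lt; lra).
  pose proof (pow2_ge_0 (B * y)). lra. }
assert (E : Re ((1 + A * (x, y)) / (1 + B * (x, y)))%C =
  (1 + (A + B) * x + A * B * (x ^ 2 + y ^ 2)) / D).
{ unfold Cdiv, Cinv, Cmult, Cplus, RtoC, Re. simpl.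
  unfold D in *. simpl in *. field.
  intros H. apply (Rgt_not_eq _ _ HD). rewrite <- H. ring. }
rewrite E.
apply Rmult_lt_reg_r with ((1 - B) * D); [apply Rmult_lt_0_compat; lra|].
replace ((1 - A) / (1 - B) * ((1 - B) * D)) with ((1 - A) * D) by (field; lra).
replace ((1 + (A + B) * x + A * B * (x ^ 2 + y ^ 2)) / D * ((1 - B) * D))
  with ((1 - B) * (1 + (A + B) * x + A * B * (x ^ 2 + y ^ 2))) by (field; lra).
apply Rlt_0_minus.
(* The factor beside [A - B] separates a term that is positive because [|w| < 1] from one that is
   nonnegative because [B >= -1], and this covers [B = -1] as well. *)
replace ((1 - B) * (1 + (A + B) * x + A * B * (x ^ 2 + y ^ 2)) - (1 - A) * D)
  with ((A - B) * (((1 - B) * (1 - (x ^ 2 + y ^ 2)) + (1 + B) * ((1 + x) ^ 2 + y ^ 2)) / 2))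
  by (unfold D; field).
assert (0 < (1 - B) * (1 - (x ^ 2 + y ^ 2))) by (apply Rmult_lt_0_compat; lra).
assert (0 <= (1 + B) * ((1 + x) ^ 2 + y ^ 2)) by (apply Rmult_le_pos; nra).
apply Rmult_lt_0_compat; lra.
Qed.

(** This is [R^n], the positive root of [x^2 + 2 tau n x - 1] with
    [tau = mu beta / (alpha + p beta)]. *)
Definition rho (p n : nat) (alpha beta mu : R) : R :=
  (sqrt ((alpha + INR p * beta) ^ 2 + (mu * beta * INR n) ^ 2)
    - mu * beta * INR n) / (alpha + INR p * beta).

Lemma rho_spec p n alpha beta mu :
  (0 < n)%nat -> 0 < beta -> 0 < alpha + INR p * beta -> 0 < mu ->
  let tau := mu * (beta / (alpha + INR p * beta)) in
  0 < rho p n alpha beta mu < 1 /\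
  1 - rho p n alpha beta mu ^ 2 = 2 * tau * INR n * rho p n alpha beta mu.
Proof.
intros Hn Hb HD Hm tau. unfold rho.
set (D := alpha + INR p * beta) in *.
apply lt_0_INR in Hn. set (N := INR n) in *.
assert (HN : 0 < mu * beta * N) by (repeat apply Rmult_lt_0_compat; assumption).
set (S := sqrt (D ^ 2 + (mu * beta * N) ^ 2)).
assert (HS : S ^ 2 = D ^ 2 + (mu * beta * N) ^ 2).
{ unfold S. rewrite pow2_sqrt; [reflexivity|nra]. }
assert (HS0 : 0 <= S) by apply sqrt_pos.
assert (HS1 : mu * beta * N < S) by nra.
assert (HS2 : S < D + mu * beta * N) by nra.
split; [split|].
- apply Rdiv_lt_0_compat; lra.
- apply Rmult_lt_reg_r with D; [lra|].
  replace ((S - mu * beta * N) / D * D) with (S - mu * beta * N) by (field; lra). lra.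
- apply Rmult_eq_reg_r with (D ^ 2); [|apply pow_nonzero; lra].
  unfold tau.
  replace ((1 - ((S - mu * beta * N) / D) ^ 2) * D ^ 2) with (D ^ 2 - S ^ 2 + 2 * S * (mu * beta * N) - (mu * beta * N) ^ 2)
    by (field; lra).
  rewrite HS. field. lra.
Qed.

Lemma pow_radius p n alpha beta mu :
  (0 < n)%nat -> 0 < rho p n alpha beta mu ->
  radius p n alpha beta mu ^ n = rho p n alpha beta mu /\ 0 < radius p n alpha beta mu.
Proof.
intros Hn Hr. assert (Hn' := lt_0_INR _ Hn). unfold radius. fold (rho p n alpha beta mu).
split; [|apply exp_pos].
unfold Rpower. rewrite <- exp_INR_mul, <- Rmult_assoc, Rinv_r, Rmult_1_l by lra.
now apply exp_ln.
Qed.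

Lemma pow_lt_mono x y n : 0 <= x -> x < y -> (0 < n)%nat -> x ^ n < y ^ n.
Proof.
intros Hx Hxy Hn. destruct n as [|n]; [lia|]. clear Hn.
induction n as [|n IH]; [simpl; lra|].
change (x * x ^ S n < y * y ^ S n). pose proof (pow_le x (S n) Hx). nra.
Qed.

Lemma radius_bound (p n : nat) (m : Z) (alpha beta mu A B : R) (f : C -> C) (z : C) :
  (0 < n)%nat -> 0 < beta -> 0 < alpha + INR p * beta -> 0 < mu ->
  -1 <= B -> B < A -> A <= 1 -> class_A p n f ->
  subordinate (div_zpow p (Theta p n m alpha beta f)) (Janowski A B) ->
  Cmod z < radius p n alpha beta mu ->
  Re ((1 - mu) * div_zpow p (Theta p n m alpha beta f) z
      + mu * div_zpow p (Theta p n (m + 1) alpha beta f) z)%C > (1 - A) / (1 - B).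
Proof.
intros Hn Hb HD Hm HB HBA HA (_ & _ & a & Ha) (w & _ & Hw & _ & Hsub) Hz.
set (kappa := (1 - A) / (1 - B)).
assert (Hk : kappa < 1).
{ unfold kappa. apply Rmult_lt_reg_r with (1 - B); [lra|].
  replace ((1 - A) / (1 - B) * (1 - B)) with (1 - A) by (field; lra). lra. }
(* The logarithmic coordinate misses the origin, where both quotients are 1 and the claim is
   [kappa < 1]. *)
destruct (Ceq_dec z (RtoC 0)) as [Hz0|Hz0].
{ unfold div_zpow. destruct (Ceq_dec z (RtoC 0)) as [_|]; [|contradiction].
  replace (((1 - mu) * 1 + mu * 1)%C) with (RtoC 1) by ring. simpl. lra. }
destruct (polar_surj z Hz0) as [t Et].
set (s := ln (Cmod z)) in *.
destruct (rho_spec p n alpha beta mu Hn Hb HD Hm) as [[Hr0 Hr1] Hr].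
set (de := beta / (alpha + INR p * beta)) in *.
destruct (pow_radius p n alpha beta mu Hn Hr0) as [Hpr Hr2].
assert (Hmz : 0 < Cmod z) by now apply Cmod_gt_0.
set (r := rho p n alpha beta mu) in *.
set (x := exp (INR n * s)).
assert (Ex : x = Cmod z ^ n).
{ unfold x. rewrite exp_INR_mul. unfold s. now rewrite exp_ln. }
assert (Hx0 : 0 < x) by apply exp_pos.
assert (Hxr : x < r).
{ rewrite Ex, <- Hpr. apply pow_lt_mono; [lra|exact Hz|exact Hn]. }
assert (Hs : s < 0).
{ apply exp_lt_inv. rewrite exp_0.
  apply Rnot_le_lt. intros H1. assert (H2 := pow_R1_Rle _ n H1).
  rewrite <- exp_INR_mul in H2. fold x in H2. lra. }
rewrite Et.
rewrite !(div_zpow_Theta p n _ alpha beta a f s t Hb HD Ha Hs).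
destruct (coef_summable p n m alpha beta a f Hb HD Ha) as [H1 H2].
set (c := coef p n m alpha beta a) in *.
set (rc := fun k => Re (c k)) in *. set (ic := fun k => Im (c k)) in *.
assert (Hc0 : forall k, (k < n)%nat -> rc k = 0 /\ ic k = 0).
{ intros k Hk'. unfold rc, ic, c, coef. rewrite trunc_lt by assumption. now split. }
(* The coefficients of [g = q - kappa]: those of [q - 1] vanish at index 0, which is free to hold
   the constant [1 - kappa]. *)
set (al := fun k : nat => if k then 1 - kappa else rc k).
assert (Hal : summable al).
{ intros u Hu. apply (proj2 (ex_series_incr_1 _)).
  exact (proj1 (ex_series_incr_1 _) (H1 u Hu)). }
assert (EX : forall s t, s < 0 -> re_sum al ic s t = 1 - kappa + re_sum rc ic s t).
{ intros u v Hu. rewrite (re_sum_split al), (re_sum_split rc) by assumption.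
  rewrite (proj1 (Hc0 0%nat Hn)), Rplus_0_l.
  unfold al at 1. f_equal. apply re_sum_ext; intros [|k]; reflexivity. }
assert (HP : forall s t, s < 0 -> 0 < re_sum al ic s t).
{ intros u v Hu. rewrite EX by assumption.
  assert (HJ := Janowski_half_plane A B (w (polar u v)) HB HBA HA (Hw _ (polar_in_U u v Hu))).
  rewrite <- (Hsub _ (polar_in_U u v Hu)) in HJ.
  rewrite (div_zpow_Theta p n _ alpha beta a f u v Hb HD Ha Hu) in HJ.
  fold c in HJ. fold rc ic in HJ. fold kappa in HJ. simpl in HJ. lra. }
assert (Hde : 0 < de) by now apply Rdiv_lt_0_compat.
assert (HR := real_part_bound al ic n s t (mu * de) Hal H2 Hn).
assert (Hk1 : summable (kmul rc)) by now apply summable_kmul.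
assert (Hk2 : summable (kmul ic)) by now apply summable_kmul.
(* The quotient for [m + 1] is [q + de z q'], by the shape of the multipliers. *)
assert (E1 : re_sum (fun k => Re (coef p n (m + 1) alpha beta a k)) (fun k => Im (coef p n (m + 1) alpha beta a k)) s t
  = re_sum rc ic s t + de * re_sum (kmul rc) (kmul ic) s t).
{ unfold re_sum. rewrite <- Series_scal_l, <- Series_plus.
  2: now apply ex_series_term.
  2: now apply ex_series_Rmult_l, ex_series_term.
  apply Series_ext. intros k.
  assert (Hpos : 1 + INR k * de <> 0) by (pose proof (pos_INR k); nra).
  assert (E : coef p n (m + 1) alpha beta a k = (RtoC (1 + INR k * de) * c k)%C).
  { unfold c. rewrite !coef_eq by assumption. fold de. rewrite powerRZ_add by assumption.
    rewrite powerRZ_1, RtoC_mult. ring. }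
  unfold term. rewrite E, re_scal_l, im_scal_l. fold (rc k) (ic k). unfold kmul. ring. }
assert (E2 : re_sum (kmul al) (kmul ic) s t = re_sum (kmul rc) (kmul ic) s t).
{ apply re_sum_ext; [|reflexivity]. intros [|k]; [|reflexivity]. unfold kmul. simpl. ring. }
rewrite E2, EX in HR by assumption.
assert (HF : 0 < 1 - kappa + re_sum rc ic s t + mu * de * re_sum (kmul rc) (kmul ic) s t).
{ apply HR; auto; try nra.
  - intros [|k] Hk'; [lia|]. apply Hc0. lia.
  - simpl. lra.
  (* At [r] the two sides agree; as [x < r], the left side is smaller and the right side larger than
     there. *)
  - fold x. cbv zeta in Hr. apply Rlt_trans with (1 - r ^ 2).
    + rewrite Hr. apply Rmult_lt_compat_l; [|exact Hxr].
      assert (0 < INR n) by now apply lt_0_INR.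
      assert (0 < mu * de) by nra. nra.
    + assert (x ^ 2 < r ^ 2) by (apply pow_lt_mono; [lra|exact Hxr|lia]). lra. }
unfold Rgt. fold kappa.
match goal with |- _ < Re ?e => assert (EE : Re e =
  (1 - mu) * (1 + re_sum rc ic s t) + mu * (1 + (re_sum rc ic s t + de * re_sum (kmul rc) (kmul ic) s t))) end.
{ rewrite re_plus, <- RtoC_minus, !re_scal_l, !re_plus. simpl. rewrite E1. reflexivity. }
rewrite EE. lra.
Qed.

(** * Divided differences and valence *)

Lemma is_derive_C_eps (f : C -> C) (z l : C) :
  @is_derive C_AbsRing C_NormedModule f z l <->
  forall eps : posreal, exists d : posreal, forall y : C,
    Cmod (y - z) < d -> Cmod (f y - f z - (y - z) * l) <= eps * Cmod (y - z).
Proof.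
split.
- intros [_ H] eps. destruct (H z (fun P HP => HP) eps) as [d Hd].
  exists d. intros y Hy. exact (Hd y Hy).
- intros H. split; [apply is_linear_scal_l|].
  intros x Hx eps. apply (is_filter_lim_locally_unique (V := AbsRing_NormedModule C_AbsRing)) in Hx. subst x.
  destruct (H eps) as [d Hd]. exists d. intros y Hy. exact (Hd y Hy).
Qed.

(** [analytic_U] differentiates into [C_NormedModule], while the product and chain rules speak of
    the ring as a module over itself. The epsilon form is the same for both. *)
Lemma is_derive_C_ring (f : C -> C) (z l : C) :
  @is_derive C_AbsRing C_NormedModule f z l <->
  @is_derive C_AbsRing (AbsRing_NormedModule C_AbsRing) f z l.
Proof.
rewrite is_derive_C_eps. split.
- intros H. split; [apply is_linear_scal_l|].
  intros x Hx eps. apply (is_filter_lim_locally_unique (V := AbsRing_NormedModule C_AbsRing)) in Hx. subst x.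
  destruct (H eps) as [d Hd]. exists d. intros y Hy. exact (Hd y Hy).
- intros [_ H] eps. destruct (H z (fun P HP => HP) eps) as [d Hd].
  exists d. intros y Hy. exact (Hd y Hy).
Qed.

Lemma analytic_const (c : C) : analytic_U (fun _ => c).
Proof. intros z _. exists (RtoC 0). apply (is_derive_const (K := C_AbsRing) (V := C_NormedModule)). Qed.

Lemma analytic_id : analytic_U (fun z => z).
Proof. intros z _. exists (RtoC 1). apply is_derive_C_ring, (is_derive_id (K := C_AbsRing)). Qed.

Lemma analytic_plus f g : analytic_U f -> analytic_U g -> analytic_U (fun z => f z + g z)%C.
Proof.
intros Hf Hg z Hz. apply (ex_derive_plus (K := C_AbsRing) (V := C_NormedModule)); auto.
Qed.

Lemma analytic_mult f g : analytic_U f -> analytic_U g -> analytic_U (fun z => f z * g z)%C.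
Proof.
intros Hf Hg z Hz. destruct (Hf z Hz) as [a Ha], (Hg z Hz) as [b Hb].
apply is_derive_C_ring in Ha, Hb. eexists. apply is_derive_C_ring.
apply (is_derive_mult (K := C_AbsRing) f g z a b Ha Hb). intros; apply Cmult_comm.
Qed.

Lemma analytic_ext f g : (forall z, f z = g z) -> analytic_U f -> analytic_U g.
Proof.
intros E Hf z Hz. apply (ex_derive_ext (K := C_AbsRing) (V := C_NormedModule) f); auto.
Qed.

Lemma analytic_minus f g : analytic_U f -> analytic_U g -> analytic_U (fun z => f z - g z)%C.
Proof.
intros Hf Hg. apply analytic_ext with (fun z => f z + (- (1)) * g z)%C; [intros; ring|].
apply analytic_plus; [exact Hf|]. apply (analytic_mult (fun _ => (- (1))%C)); [apply analytic_const|exact Hg].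
Qed.

Lemma analytic_pow f k : analytic_U f -> analytic_U (fun z => f z ^ k)%C.
Proof.
intros Hf. induction k as [|k IH].
- apply (analytic_const (RtoC 1)).
- now apply (analytic_mult f (fun z => f z ^ k)%C).
Qed.

Lemma is_derive_Cinv (z : C) :
  z <> RtoC 0 -> @is_derive C_AbsRing C_NormedModule Cinv z (- / (z * z))%C.
Proof.
intros Hz. apply is_derive_C_eps. intros eps.
assert (Hm : 0 < Cmod z) by now apply Cmod_gt_0.
set (m := Cmod z) in *.
assert (Hd : 0 < Rmin (m / 2) (eps * m ^ 3 / 2)).
{ destruct eps as [e He]; simpl. apply Rmin_pos; [lra|].
  apply Rdiv_lt_0_compat; [|lra]. apply Rmult_lt_0_compat; [exact He|]. exact (pow_lt m 3 Hm). }
exists (mkposreal _ Hd). intros y Hy. simpl in Hy.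
assert (Hy1 : Cmod (y - z) < m / 2) by (apply Rlt_le_trans with (1 := Hy), Rmin_l).
assert (Hy2 : Cmod (y - z) < eps * m ^ 3 / 2) by (apply Rlt_le_trans with (1 := Hy), Rmin_r).
assert (Hym : m / 2 < Cmod y).
{ assert (H := Cmod_triangle y (z - y)). replace (y + (z - y))%C with z in H by ring.
  fold m in H. rewrite <- Cmod_opp in Hy1. replace (- (y - z))%C with (z - y)%C in Hy1 by ring. lra. }
assert (Hy0 : y <> RtoC 0) by (apply Cmod_gt_0; lra).
replace (/ y - / z - (y - z) * - / (z * z))%C with ((y - z) * ((y - z) / (z * z * y)))%C by (field; auto).
rewrite Cmod_mult, Rmult_comm. apply Rmult_le_compat_r; [apply Cmod_ge_0|].
unfold Cdiv. rewrite Cmod_mult, Cmod_inv by (apply Cmult_neq_0; [now apply Cmult_neq_0|exact Hy0]).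
rewrite !Cmod_mult. fold m.
assert (Hk : 0 < m * m * Cmod y) by (apply Rmult_lt_0_compat; [nra|lra]).
apply Rmult_le_reg_r with (m * m * Cmod y); [exact Hk|].
rewrite Rmult_assoc, Rinv_l, Rmult_1_r by lra.
apply Rle_trans with (eps * m ^ 3 / 2); [lra|].
destruct eps as [e He]; simpl in *.
assert (e * (m * m) * (m / 2) <= e * (m * m) * Cmod y).
{ apply Rmult_le_compat_l; [|lra]. apply Rmult_le_pos; nra. }
lra.
Qed.

Lemma analytic_inv f :
  analytic_U f -> (forall z, in_U z -> f z <> RtoC 0) -> analytic_U (fun z => / f z)%C.
Proof.
intros Hf H0 z Hz. destruct (Hf z Hz) as [a Ha]. apply is_derive_C_ring in Ha.
assert (HI := is_derive_Cinv (f z) (H0 z Hz)).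
eexists. apply (is_derive_comp (K := C_AbsRing) (V := C_NormedModule) Cinv f z _ _ HI Ha).
Qed.

Lemma analytic_continuous f z eps :
  analytic_U f -> in_U z -> 0 < eps ->
  exists d, 0 < d /\ forall y, Cmod (y - z) < d -> Cmod (f y - f z) < eps.
Proof.
intros Hf Hz He. destruct (Hf z Hz) as [a Ha].
destruct (proj1 (is_derive_C_eps f z a) Ha (mkposreal 1 Rlt_0_1)) as [d Hd].
assert (Ha0 := Cmod_ge_0 a).
assert (Hp : 0 < eps / (Cmod a + 2)) by (apply Rdiv_lt_0_compat; lra).
exists (Rmin d (eps / (Cmod a + 2))). split.
{ apply Rmin_pos; [apply cond_pos|exact Hp]. }
intros y Hy.
assert (Hy1 : Cmod (y - z) < d) by (apply Rlt_le_trans with (1 := Hy), Rmin_l).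
assert (Hy2 : Cmod (y - z) < eps / (Cmod a + 2)) by (apply Rlt_le_trans with (1 := Hy), Rmin_r).
specialize (Hd y Hy1). simpl in Hd.
replace (f y - f z)%C with ((f y - f z - (y - z) * a) + (y - z) * a)%C by ring.
apply Rle_lt_trans with (1 := Cmod_triangle _ _). rewrite (Cmod_mult (y - z) a).
assert (E : eps = eps / (Cmod a + 2) * (Cmod a + 2)) by (field; lra).
set (q := eps / (Cmod a + 2)) in *. pose proof (Cmod_ge_0 (y - z)). nra.
Qed.

(** By continuity, tested at [x + h] with [h] a small positive real. It justifies cancelling [z - x]
    at the root [x] itself. *)
Lemma analytic_eq_punctured f g x :
  analytic_U f -> analytic_U g -> in_U x ->
  (forall z, in_U z -> z <> x -> f z = g z) -> f x = g x.
Proof.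
intros Hf Hg Hx H. apply NNPP. intros Hne.
assert (HD := analytic_minus f g Hf Hg).
assert (Hpos : 0 < Cmod (f x - g x)).
{ apply Cmod_gt_0. intros E. apply Hne. replace (f x) with (f x - g x + g x)%C by ring. rewrite E. ring. }
destruct (analytic_continuous _ x _ HD Hx Hpos) as (d & Hd & Hc).
unfold in_U in Hx.
set (h := Rmin (d / 2) ((1 - Cmod x) / 2)).
assert (Hh : 0 < h) by (apply Rmin_pos; lra).
assert (Hh1 : h <= d / 2) by apply Rmin_l.
assert (Hh2 : h <= (1 - Cmod x) / 2) by apply Rmin_r.
assert (E1 : Cmod (x + h - x) = h).
{ replace (x + h - x)%C with (RtoC h) by ring. rewrite Cmod_R. apply Rabs_pos_eq. lra. }
specialize (Hc (x + h)%C ltac:(rewrite E1; lra)). cbv beta in Hc.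
rewrite (H (x + h)%C) in Hc.
- replace (g (x + h) - g (x + h) - (f x - g x))%C with (- (f x - g x))%C in Hc by ring.
  rewrite Cmod_opp in Hc. lra.
- unfold in_U. apply Rle_lt_trans with (1 := Cmod_triangle _ _).
  rewrite Cmod_R, Rabs_pos_eq; lra.
- intros E. apply (f_equal (fun u => u - x)%C) in E.
  apply (f_equal Cmod) in E. rewrite E1 in E. replace (x - x)%C with (RtoC 0) in E by ring.
  rewrite Cmod_0 in E. lra.
Qed.

(** All divided differences of order [k] of [F] at points of the disc are
    within [M] of [c]. *)
Fixpoint divdiff_near (k : nat) (F : C -> C) (c : C) (M : R) : Prop :=
  match k with
  | O => forall z, in_U z -> Cmod (F z - c) <= M
  | S k => forall x, in_U x -> exists G, analytic_U G /\
             (forall z, F z - F x = (z - x) * G z)%C /\ divdiff_near k G c M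
  end.

Lemma divdiff_ext k F G c M :
  (forall z, F z = G z) -> divdiff_near k F c M -> divdiff_near k G c M.
Proof.
intros E. destruct k as [|k]; simpl.
- intros H z Hz. rewrite <- E. now apply H.
- intros H x Hx. destruct (H x Hx) as (G' & H1 & H2 & H3). exists G'.
  split; [exact H1|split; [|exact H3]]. intros z. now rewrite <- !E.
Qed.

Lemma divdiff_plus k F G c d M N :
  divdiff_near k F c M -> divdiff_near k G d N ->
  divdiff_near k (fun z => F z + G z)%C (c + d)%C (M + N).
Proof.
revert F G. induction k as [|k IH]; simpl; intros F G HF HG.
- intros z Hz. replace (F z + G z - (c + d))%C with ((F z - c) + (G z - d))%C by ring.
  apply Rle_trans with (1 := Cmod_triangle _ _). apply Rplus_le_compat; auto.
- intros x Hx. destruct (HF x Hx) as (F' & A1 & A2 & A3), (HG x Hx) as (G' & B1 & B2 & B3).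
  exists (fun z => F' z + G' z)%C. split; [now apply analytic_plus|split; [|now apply IH]].
  intros z. replace (F z + G z - (F x + G x))%C with ((F z - F x) + (G z - G x))%C by ring.
  rewrite A2, B2. ring.
Qed.

Lemma divdiff_scal k F c M a :
  divdiff_near k F c M -> divdiff_near k (fun z => a * F z)%C (a * c)%C (Cmod a * M).
Proof.
revert F. induction k as [|k IH]; simpl; intros F HF.
- intros z Hz. replace (a * F z - a * c)%C with (a * (F z - c))%C by ring.
  rewrite Cmod_mult. apply Rmult_le_compat_l; [apply Cmod_ge_0|auto].
- intros x Hx. destruct (HF x Hx) as (F' & A1 & A2 & A3).
  exists (fun z => a * F' z)%C. split; [apply analytic_mult; [apply analytic_const|exact A1]|split; [|now apply IH]].
  intros z. replace (a * F z - a * F x)%C with (a * (F z - F x))%C by ring.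
  rewrite A2. ring.
Qed.

Lemma divdiff_weaken k F c M N : M <= N -> divdiff_near k F c M -> divdiff_near k F c N.
Proof.
intros HMN. revert F. induction k as [|k IH]; simpl; intros F HF.
- intros z Hz. apply Rle_trans with (2 := HMN). auto.
- intros x Hx. destruct (HF x Hx) as (F' & A1 & A2 & A3). exists F'. auto.
Qed.

Lemma divdiff_zero k : divdiff_near k (fun _ => RtoC 0) (RtoC 0) 0.
Proof.
induction k as [|k IH]; simpl.
- intros z _. replace (0 - 0)%C with (RtoC 0) by ring. rewrite Cmod_0. lra.
- intros x _. exists (fun _ => RtoC 0). split; [apply analytic_const|split; [intros; ring|exact IH]].
Qed.

(** [z^(j+1) - x^(j+1) = (z - x) (z^j + x G_j(z))] when [z^j - x^j = (z - x) G_j(z)]. *)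
Lemma divdiff_pow_step k j c M N :
  divdiff_near k (fun z => z ^ j)%C c M -> divdiff_near (S k) (fun z => z ^ j)%C (RtoC 0) N ->
  0 <= N -> divdiff_near (S k) (fun z => z ^ S j)%C c (M + N).
Proof.
intros H1 H2 HN x Hx. destruct (H2 x Hx) as (G & A1 & A2 & A3).
exists (fun z => z ^ j + x * G z)%C. split; [|split].
- apply analytic_plus; [apply analytic_pow, analytic_id|].
  apply analytic_mult; [apply analytic_const|exact A1].
- intros z. change (z * z ^ j - x * x ^ j = (z - x) * (z ^ j + x * G z))%C.
  replace (z * z ^ j - x * x ^ j)%C with ((z - x) * z ^ j + x * (z ^ j - x ^ j))%C by ring.
  rewrite A2. ring.
- replace c with (c + x * 0)%C by ring. apply divdiff_plus; [exact H1|].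
  apply divdiff_weaken with (Cmod x * N); [unfold in_U in Hx; nra|].
  now apply divdiff_scal.
Qed.

(** Only the existence of a bound for the powers above [p] matters: a small coefficient will
    outweigh it. *)
Lemma divdiff_pow_bound k j : exists M, 0 <= M /\ divdiff_near k (fun z => z ^ j)%C (RtoC 0) M.
Proof.
revert j. induction k as [|k IH]; intros j.
- exists 1. split; [lra|]. intros z Hz. replace (z ^ j - 0)%C with (z ^ j)%C by ring.
  rewrite Cmod_pow. rewrite <- (pow1 j). apply pow_incr. split; [apply Cmod_ge_0|left; exact Hz].
- induction j as [|j [N [HN IHj]]].
  + exists 0. split; [lra|]. intros x _. exists (fun _ => RtoC 0).
    split; [apply analytic_const|split; [intros; simpl; ring|apply divdiff_zero]].
  + destruct (IH j) as [M [HM H]]. exists (M + N). split; [lra|].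
    now apply (divdiff_pow_step k j (RtoC 0)).
Qed.

Lemma divdiff_pow_lt k j : (j < k)%nat -> divdiff_near k (fun z => z ^ j)%C (RtoC 0) 0.
Proof.
revert j. induction k as [|k IH]; intros j Hj; [lia|].
induction j as [|j IHj].
- intros x _. exists (fun _ => RtoC 0).
  split; [apply analytic_const|split; [intros; simpl; ring|apply divdiff_zero]].
- apply divdiff_weaken with (0 + 0); [lra|].
  apply (divdiff_pow_step k j (RtoC 0)); [apply IH; lia|apply IHj; lia|lra].
Qed.

(** The divided differences of order [k] of [z^k] are identically 1, so a small perturbation of
    [z^k] has none that vanish. *)
Lemma divdiff_pow_eq k : divdiff_near k (fun z => z ^ k)%C (RtoC 1) 0.
Proof.
induction k as [|k IH].
- intros z _. simpl. replace (1 - 1)%C with (RtoC 0) by ring. rewrite Cmod_0. lra.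
- apply divdiff_weaken with (0 + 0); [lra|].
  apply (divdiff_pow_step k k (RtoC 1)); [exact IH|apply divdiff_pow_lt; lia|lra].
Qed.

(** * Counting roots by divided differences *)

Definition root_product (xs : list C) (z : C) : C :=
  fold_right Cmult (RtoC 1) (map (fun x => (z - x)%C) xs).

Lemma analytic_root_product xs : analytic_U (root_product xs).
Proof.
induction xs as [|x xs IH].
- apply (analytic_const (RtoC 1)).
- apply (analytic_mult (fun z => z - x)%C); [|exact IH].
  apply analytic_minus; [apply analytic_id|apply analytic_const].
Qed.

(** Each root [x] is removed by passing from [F] to its divided difference at [x], which keeps the
    other roots, repeated ones included. After [k] steps a function within [M < 1] of 1 would still
    vanish somewhere. *)
Lemma divdiff_few_roots k F M (xs : list C) (g : C -> C) :
  divdiff_near k F (RtoC 1) M -> M < 1 -> length xs = S k -> List.Forall in_U xs -> analytic_U g ->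
  (forall z, in_U z -> F z = root_product xs z * g z)%C -> False.
Proof.
revert F xs. induction k as [|k IH]; intros F xs HF HM Hlen HU Hg HFz.
- destruct xs as [|x xs]; [discriminate|].
  inversion HU as [|? ? Hx _]; subst.
  specialize (HF x Hx). rewrite (HFz x Hx) in HF. unfold root_product in HF. simpl in HF.
  replace ((x - x) * fold_right Cmult 1 (map (fun x0 => x - x0) xs) * g x - 1)%C with (- (1))%C in HF by ring.
  rewrite Cmod_opp, Cmod_1 in HF. lra.
- destruct xs as [|x xs]; [discriminate|].
  inversion HU as [|? ? Hx HU']; subst.
  destruct (HF x Hx) as (G & A1 & A2 & A3).
  assert (Hprod : forall z, root_product (x :: xs) z = ((z - x) * root_product xs z)%C) by reflexivity.
  assert (F0 : F x = RtoC 0) by (rewrite (HFz x Hx), Hprod; ring).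
  assert (Hne : forall z, in_U z -> z <> x -> G z = (root_product xs z * g z)%C).
  { intros z Hz Hzx. specialize (A2 z). rewrite F0, (HFz z Hz), Hprod in A2.
    assert (Hd : (z - x)%C <> RtoC 0).
    { intros E. apply Hzx. replace z with (z - x + x)%C by ring. rewrite E. ring. }
    replace (G z) with ((z - x) * G z / (z - x))%C by (field; exact Hd).
    rewrite <- A2. field. exact Hd. }
  apply (IH G xs A3 HM); auto.
  intros z Hz. destruct (Ceq_dec z x) as [->|Hzx]; [|now apply Hne].
  apply (analytic_eq_punctured G (fun z => root_product xs z * g z)%C); auto.
  apply analytic_mult; [apply analytic_root_product|exact Hg].
Qed.

(** Subtracting [c] does not change divided differences of order at least 1, so one bound serves all
    values [c]. *)
Lemma divdiff_no_extra_roots p f M c :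
  (0 < p)%nat -> divdiff_near p f (RtoC 1) M -> M < 1 -> ~ has_roots f c (S p).
Proof.
intros Hp Hf HM (zs & Hlen & HU & g & Hg & E).
destruct p as [|p]; [lia|].
apply (divdiff_few_roots (S p) (fun z => f z - c)%C M zs g); auto.
intros x Hx. destruct (Hf x Hx) as (G & A1 & A2 & A3). exists G.
split; [exact A1|split; [|exact A3]]. intros z. rewrite <- A2. ring.
Qed.

(** * The extremal polynomial *)

(** [g 1 + ... + g N]: the index starts at 1. *)
Fixpoint csum (g : nat -> C) (N : nat) : C :=
  match N with O => RtoC 0 | S N' => (csum g N' + g (S N'))%C end.

Lemma csum_S g N : csum g (S N) = (csum g N + g (S N))%C.
Proof. reflexivity. Qed.

Lemma csum_ext g h N :
  (forall j, (0 < j)%nat -> g j = h j) -> csum g N = csum h N.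
Proof.
intros E. induction N as [|N IH]; [reflexivity|]. simpl. rewrite IH, E by lia. reflexivity.
Qed.

Lemma csum_scal c g N : (c * csum g N)%C = csum (fun j => c * g j)%C N.
Proof.
induction N as [|N IH]; simpl; [ring|]. rewrite <- IH. ring.
Qed.

Lemma analytic_csum (g : nat -> C -> C) N :
  (forall j, analytic_U (g j)) -> analytic_U (fun z => csum (fun j => g j z) N).
Proof.
intros H. induction N as [|N IH]; simpl; [apply analytic_const|].
now apply analytic_plus.
Qed.

Lemma is_series_single (K N : nat) (c z : C) :
  (N <= K)%nat ->
  @is_series C_AbsRing C_NormedModule
    (fun i => (if N + i =? K then c else RtoC 0) * z ^ (N + i))%C (c * z ^ K)%C.
Proof.
intros HK.
apply (is_series_shift (fun k => (if k =? K then c else RtoC 0) * z ^ k)%C N).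
{ intros k Hk. replace (k =? K) with false by (symmetry; apply Nat.eqb_neq; lia). ring. }
apply (is_series_shift _ K).
{ intros k Hk. replace (k =? K) with false by (symmetry; apply Nat.eqb_neq; lia). ring. }
apply is_series_C.
assert (HS : forall (u : nat -> R) l, u 0%nat = l -> (forall j, u (S j) = 0) -> is_series u l).
{ intros u l H0 HS. apply filterlim_ext with (fun _ => l); [|apply filterlim_const].
  intros M. induction M as [|M IH]; [now rewrite sum_O|].
  rewrite sum_Sn, <- IH, HS. symmetry. apply Rplus_0_r. }
assert (E0 : (K + 0 =? K) = true) by (apply Nat.eqb_eq; lia).
assert (ES : forall j, (K + S j =? K) = false) by (intros; apply Nat.eqb_neq; lia).
split; apply HS.
- now rewrite E0, Nat.add_0_r.
- intros j. rewrite ES, Cmult_0_l. reflexivity.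
- now rewrite E0, Nat.add_0_r.
- intros j. rewrite ES, Cmult_0_l. reflexivity.
Qed.

Lemma is_series_csum (K : nat -> nat) (c : nat -> C) (N0 N : nat) (z : C) :
  (forall j, (0 < j)%nat -> (N0 <= K j)%nat) ->
  @is_series C_AbsRing C_NormedModule
    (fun i => csum (fun j => if N0 + i =? K j then c j else RtoC 0) N * z ^ (N0 + i))%C
    (csum (fun j => c j * z ^ K j)%C N).
Proof.
intros HK. induction N as [|N IH].
- apply is_series_C. split;
   (apply is_series_ext with (fun _ => 0); [intros; simpl; ring|];
    apply filterlim_ext with (fun _ => 0); [|apply filterlim_const];
    intros M; induction M as [|M IHM]; [now rewrite sum_O|];
    rewrite sum_Sn, <- IHM; symmetry; apply Rplus_0_r).
- assert (H := is_series_plus (K := C_AbsRing) (V := C_NormedModule) _ _ _ _ IH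
    (is_series_single (K (S N)) N0 (c (S N)) z (HK (S N) ltac:(lia)))).
  apply (is_series_ext (K := C_AbsRing) (V := C_NormedModule)) with (2 := H).
  intros i. simpl csum.
  match goal with |- plus (Cmult ?a ?b) (Cmult ?d ?b) = _ => change (a * b + d * b = (a + d) * b)%C end.
  ring.
Qed.

(** Only exponents [p + n * j] occur, so that the quotients by [z^p] are polynomials in [z^n]. Their
    values at [z] depend only on [z^n]. *)
Definition poly_fun (p n : nat) (c : nat -> C) (N : nat) (z : C) : C := (z ^ p + csum (fun j => c j * z ^ (p + n * j)) N)%C.
Definition poly_coef (p n : nat) (c : nat -> C) (N k : nat) : C := csum (fun j => if k =? p + n * j then c j else RtoC 0) N.

Lemma poly_expansion p n c N z :
  (0 < n)%nat -> is_expansion p n (poly_coef p n c N) z (poly_fun p n c N z).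
Proof.
intros Hn. unfold is_expansion, poly_fun, poly_coef.
replace (z ^ p + csum (fun j => c j * z ^ (p + n * j)) N - z ^ p)%C
  with (csum (fun j => c j * z ^ (p + n * j)) N)%C by ring.
apply (is_series_csum (fun j => p + n * j)%nat). intros j Hj. cbv beta.
assert (n * 1 <= n * j)%nat by (apply Nat.mul_le_mono_l; lia). lia.
Qed.

Lemma poly_Theta p n m alpha beta c N z :
  (0 < n)%nat ->
  Theta p n m alpha beta (poly_fun p n c N) z =
  (z ^ p + csum (fun j => RtoC (powerRZ ((alpha + INR (p + n * j) * beta) / (alpha + INR p * beta)) m) * c j
       * z ^ (p + n * j)) N)%C.
Proof.
intros Hn. apply (Theta_unique p n m alpha beta (poly_coef p n c N)).
{ intros; now apply poly_expansion. }
unfold is_expansion.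
match goal with |- is_series _ (?a + ?b - ?a)%C => replace (a + b - a)%C with b by ring end.
assert (H := is_series_csum (fun j => p + n * j)%nat
  (fun j => RtoC (powerRZ ((alpha + INR (p + n * j) * beta) / (alpha + INR p * beta)) m) * c j)%C
  (p + n) N z ltac:(intros j Hj; cbv beta; assert (n * 1 <= n * j)%nat by (apply Nat.mul_le_mono_l; lia); lia)).
apply (is_series_ext (K := C_AbsRing) (V := C_NormedModule)) with (2 := H).
intros i. f_equal. unfold poly_coef. rewrite csum_scal. apply csum_ext. intros j Hj.
destruct (Nat.eqb_spec (p + n + i) (p + n * j)) as [->|_]; [reflexivity|ring].
Qed.

Lemma poly_div_zpow p n m alpha beta c N z :
  (0 < n)%nat ->
  div_zpow p (Theta p n m alpha beta (poly_fun p n c N)) z =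
  (1 + csum (fun j => RtoC (powerRZ ((alpha + INR (p + n * j) * beta) / (alpha + INR p * beta)) m) * c j
       * (z ^ n) ^ j) N)%C.
Proof.
intros Hn. unfold div_zpow. destruct (Ceq_dec z (RtoC 0)) as [->|Hz].
- transitivity (1 + csum (fun j => RtoC 0 * RtoC 0)%C N)%C.
  + rewrite <- csum_scal. ring.
  + f_equal. apply csum_ext. intros j Hj.
    destruct n as [|n']; [lia|]. destruct j as [|j]; [lia|]. simpl. ring.
- rewrite poly_Theta by exact Hn. unfold Cdiv. rewrite Cmult_plus_distr_r. f_equal.
  + field. now apply Cpow_nz.
  + rewrite Cmult_comm, csum_scal. apply csum_ext. intros j Hj.
    rewrite Cpow_add_r, Cpow_mult_r. field. now apply Cpow_nz.
Qed.

Lemma poly_analytic p n c N : analytic_U (poly_fun p n c N).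
Proof.
apply analytic_plus; [apply analytic_pow, analytic_id|].
apply (analytic_csum (fun j z => c j * z ^ (p + n * j))%C). intros j.
apply analytic_mult; [apply analytic_const|apply analytic_pow, analytic_id].
Qed.

Lemma poly_has_roots p n c N : has_roots (poly_fun p n c N) (RtoC 0) p.
Proof.
exists (repeat (RtoC 0) p). split; [apply repeat_length|]. split.
{ apply List.Forall_forall. intros x Hx. apply repeat_spec in Hx. subst x.
  unfold in_U. rewrite Cmod_0. lra. }
exists (fun z => 1 + csum (fun j => c j * z ^ (n * j)) N)%C. split.
- apply analytic_plus; [apply analytic_const|].
  apply (analytic_csum (fun j z => c j * z ^ (n * j))%C). intros j.
  apply analytic_mult; [apply analytic_const|apply analytic_pow, analytic_id].
- intros z _.
  assert (E : fold_right Cmult 1%C (map (fun x : C => z - x)%C (repeat (RtoC 0) p)) = (z ^ p)%C).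
  { clear. induction p as [|q IH]; [reflexivity|]. simpl. rewrite IH. ring. }
  rewrite E, Cmult_plus_distr_l, csum_scal. unfold poly_fun.
  rewrite (csum_ext (fun j => z ^ p * (c j * z ^ (n * j)))%C (fun j => c j * z ^ (p + n * j))%C).
  + ring.
  + intros j _. rewrite Cpow_add_r. ring.
Qed.

Lemma csum_pow_divdiff p n (g : nat -> C) N :
  exists M, 0 <= M /\ divdiff_near p (fun z => csum (fun j => g j * z ^ (p + n * j))%C N) (RtoC 0) M.
Proof.
induction N as [|N (M & HM & IH)].
- exists 0. split; [lra|]. apply divdiff_zero.
- destruct (divdiff_pow_bound p (p + n * S N)) as (M' & HM' & H).
  exists (M + Cmod (g (S N)) * M'). split.
  + pose proof (Cmod_ge_0 (g (S N))). nra.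
  + replace (RtoC 0) with (0 + g (S N) * 0)%C by ring.
    apply (divdiff_plus p (fun z => csum (fun j => g j * z ^ (p + n * j))%C N)); [exact IH|].
    now apply divdiff_scal.
Qed.

Lemma poly_class_A p n (g : nat -> C) N :
  (0 < p)%nat -> (0 < n)%nat ->
  exists e, 0 < e <= 1 /\ class_A p n (poly_fun p n (fun j => RtoC e * g j)%C N).
Proof.
intros Hp Hn.
destruct (csum_pow_divdiff p n g N) as (M & HM & H).
(* This gives [e * M < 1], the condition for counting roots; [e <= 1] will ensure [A <= 1]. *)
set (e := / (M + 1)).
assert (He : 0 < e) by (apply Rinv_0_lt_compat; lra).
assert (HeM : e * (M + 1) = 1) by (unfold e; field; lra).
exists e. split; [split; [exact He|nra]|].
split; [apply poly_analytic|split; [split|]].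
- intros c. apply (divdiff_no_extra_roots p _ (0 + Cmod e * M)); [exact Hp| |].
  + replace (RtoC 1) with (1 + e * 0)%C by ring.
    apply (divdiff_plus p (fun z => z ^ p)%C); [apply divdiff_pow_eq|].
    apply divdiff_ext with (fun z => e * csum (fun j => g j * z ^ (p + n * j))%C N)%C.
    * intros z. rewrite csum_scal. apply csum_ext. intros. ring.
    * now apply divdiff_scal.
  + rewrite Cmod_R, Rabs_pos_eq by lra. nra.
- exists (RtoC 0). apply poly_has_roots.
- exists (poly_coef p n (fun j => RtoC e * g j)%C N). intros z _. now apply poly_expansion.
Qed.

(** * Half-plane bounds for truncated geometric sums *)

Lemma geometric_csum (y : C) N :
  ((1 - y) * (1 + 2 * csum (fun j => y ^ j) N) = 1 + y - 2 * y ^ S N)%C.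
Proof.
induction N as [|N IH].
- simpl. ring.
- rewrite csum_S. cbv beta.
  replace ((1 - y) * (1 + 2 * (csum (fun j => y ^ j) N + y ^ S N)))%C
   with ((1 - y) * (1 + 2 * csum (fun j => y ^ j) N) + (1 - y) * 2 * y ^ S N)%C by ring.
  rewrite IH. simpl. ring.
Qed.

(** For the full series, [Re ((1 + y) / (1 - y)) = (1 - |y|^2) / |1 - y|^2]. Truncation changes the
    numerator by at most [4 th^(N+1)], since [|1 - y| <= 2]. *)
Lemma geometric_half_plane (y : C) (th : R) N :
  0 < th < 1 -> Cmod y <= th -> 4 * th ^ S N < 1 - th ^ 2 ->
  0 < Re (1 + 2 * csum (fun j => y ^ j) N)%C.
Proof.
intros Ht Hy HN. set (G := (1 + 2 * csum (fun j => y ^ j) N)%C).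
assert (EG : ((1 - y) * G = 1 + y - 2 * y ^ S N)%C) by apply geometric_csum.
assert (Hy0 := Cmod_ge_0 y).
assert (Hv : Cmod (y ^ S N) <= th ^ S N) by (rewrite Cmod_pow; apply pow_incr; lra).
set (v := (y ^ S N)%C) in *.
assert (H1 : Rabs (Re (Cconj (1 - y) * v)%C) <= 2 * th ^ S N).
{ apply Rle_trans with (1 := re_le_Cmod _). rewrite Cmod_mult, Cmod_conj.
  apply Rmult_le_compat; try apply Cmod_ge_0; [|exact Hv].
  apply Rle_trans with (1 := Cmod_triangle _ _). rewrite Cmod_1, Cmod_opp. lra. }
apply Rabs_le_between in H1.
assert (HyN : Re y ^ 2 + Im y ^ 2 <= th ^ 2).
{ rewrite <- Cmod2_alt. apply pow_incr. lra. }
assert (E : ((1 - Re y) ^ 2 + Im y ^ 2) * Re G = 1 - (Re y ^ 2 + Im y ^ 2) - 2 * Re (Cconj (1 - y) * v)%C).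
{ assert (E2 : Re (Cconj (1 - y) * ((1 - y) * G))%C = Re (Cconj (1 - y) * (1 + y - 2 * v))%C) by now rewrite EG.
  destruct y as [y1 y2], G as [g1 g2], v as [v1 v2].
  unfold Cconj, Cmult, Cminus, Cplus, Copp, RtoC, Re, Im in *. simpl in *. lra. }
assert (0 < (1 - Re y) ^ 2 + Im y ^ 2).
{ assert (Hr : Rabs (Re y) <= th) by (apply Rle_trans with (1 := re_le_Cmod y); exact Hy).
  apply Rabs_le_between in Hr. assert (0 < (1 - Re y) ^ 2) by (apply pow_lt; lra).
  pose proof (pow2_ge_0 (Im y)). lra. }
nra.
Qed.

(** Partial sums of [1 + 2 sum (1 + t j) (-y)^j], whose closed form in the limit
    is [(1 - y^2 - 2 t y) / (1 + y)^2]; for odd [N] the remainder is negative. *)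
Lemma alternating_csum (y t : R) N :
  ((1 + y) ^ 2 * (1 + 2 * csum (fun j => RtoC (1 + t * INR j) * RtoC (- y) ^ j) N))%C =
  RtoC (1 - y ^ 2 - 2 * t * y
    - 2 * (- y) ^ S N * ((1 + t * INR (S N)) * (1 + y) - t * y)).
Proof.
induction N as [|N IH].
- simpl csum. change (INR 1) with 1. unfold RtoC, Cplus, Cmult. simpl. f_equal; ring.
- rewrite csum_S. cbv beta.
  replace ((1 + y) ^ 2 * (1 + 2 * (csum (fun j => RtoC (1 + t * INR j) * RtoC (- y) ^ j) N
      + RtoC (1 + t * INR (S N)) * RtoC (- y) ^ S N)))%C
   with ((1 + y) ^ 2 * (1 + 2 * csum (fun j => RtoC (1 + t * INR j) * RtoC (- y) ^ j) N)
      + (1 + y) ^ 2 * 2 * (RtoC (1 + t * INR (S N)) * RtoC (- y) ^ S N))%C by ring.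
  rewrite IH, (S_INR (S N)), <- RtoC_pow, <- RtoC_plus, <- RtoC_pow, <- !RtoC_mult, <- RtoC_plus.
  f_equal. simpl pow. ring.
Qed.

(** The hypothesis on [y] makes the closed form vanish, so only the remainder is left; with an odd
    number of terms [(- y)^(N+1)] is positive and the remainder has the wanted sign. *)
Lemma alternating_csum_neg (y t : R) M :
  0 < y < 1 -> 0 < t -> 1 - y ^ 2 = 2 * t * y ->
  Re (1 + 2 * csum (fun j => RtoC (1 + t * INR j) * RtoC (- y) ^ j) (2 * M + 1))%C <= 0.
Proof.
intros Hy Ht E.
assert (HA := alternating_csum y t (2 * M + 1)).
set (G := (1 + 2 * csum _ _)%C) in *. clearbody G.
apply (f_equal Re) in HA. rewrite <- RtoC_plus, <- RtoC_pow, re_scal_l in HA.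
assert (Hp : 0 < (- y) ^ S (2 * M + 1)).
{ replace (S (2 * M + 1)) with (2 * S M)%nat by lia. rewrite pow_mult.
  apply pow_lt. simpl. nra. }
assert (HI : 0 <= INR (S (2 * M + 1))) by apply pos_INR.
assert (H1 : 0 < (1 + t * INR (S (2 * M + 1))) * (1 + y) - t * y).
{ assert (HK : 1 <= INR (S (2 * M + 1))) by (rewrite S_INR; pose proof (pos_INR (2 * M + 1)); lra).
  set (K := INR (S (2 * M + 1))) in *.
  assert (0 <= t * y * (K - 1)) by (apply Rmult_le_pos; nra).
  assert (0 <= t * K) by nra. nra. }
assert (0 < (1 + y) ^ 2) by (apply pow_lt; lra).
assert (0 < (- y) ^ S (2 * M + 1) * ((1 + t * INR (S (2 * M + 1))) * (1 + y) - t * y)) by now apply Rmult_lt_0_compat.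
assert (HA' : (1 + y) ^ 2 * Re G <= 0).
{ rewrite HA. unfold Re at 1, RtoC at 1. cbv [fst]. lra. }
apply Rnot_lt_le. intros HG. nra.
Qed.

(** Solving [F = (1 + A w) / (1 - w)] gives [w = (F - 1) / (A + F)], and [|A + F|^2 - |F - 1|^2 = (1
    + A) (2 Re F - (1 - A))] is positive exactly on the half-plane. *)
Lemma subordinate_half_plane (F : C -> C) (A : R) :
  -1 < A -> analytic_U F -> F (RtoC 0) = RtoC 1 ->
  (forall z, in_U z -> (1 - A) / 2 < Re (F z)) -> subordinate F (Janowski A (-1)).
Proof.
intros HA HF H0 Hre.
assert (Hne : forall z, in_U z -> (A + F z)%C <> RtoC 0).
{ intros z Hz E. apply (f_equal Re) in E. rewrite re_plus in E. simpl in E. specialize (Hre z Hz). lra. }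
exists (fun z => (F z - 1) * / (A + F z))%C. split; [|split; [|split]].
- apply (analytic_mult (fun z => F z - 1)%C (fun z => / (A + F z))%C).
  + apply analytic_minus; [exact HF|apply analytic_const].
  + apply (analytic_inv (fun z => A + F z)%C); [|exact Hne].
    apply analytic_plus; [apply analytic_const|exact HF].
- intros z Hz. unfold in_U. rewrite Cmod_mult, Cmod_inv by now apply Hne.
  assert (Hp : 0 < Cmod (A + F z)%C) by now apply Cmod_gt_0, Hne.
  apply Rmult_lt_reg_r with (Cmod (A + F z)%C); [exact Hp|].
  rewrite Rmult_assoc, Rinv_l, Rmult_1_r, Rmult_1_l by lra.
  assert (Hc := Cmod_ge_0 (F z - 1)%C).
  assert (Cmod (F z - 1)%C ^ 2 < Cmod (A + F z)%C ^ 2).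
  { rewrite !Cmod2_alt. specialize (Hre z Hz). destruct (F z) as [x y].
    unfold Re, Im in *. simpl in *. nra. }
  nra.
- rewrite H0. ring.
- intros z Hz. specialize (Hne z Hz). unfold Janowski.
  assert (HA1 : (1 + A)%C <> RtoC 0).
  { rewrite <- RtoC_plus. intros E. apply RtoC_inj in E. lra. }
  set (u := F z) in *.
  replace (1 + (-1) * ((u - 1) * / (A + u)))%C with ((1 + A) / (A + u))%C by (field; exact Hne).
  replace (1 + A * ((u - 1) * / (A + u)))%C with ((1 + A) * u / (A + u))%C by (field; exact Hne).
  field. split; [exact Hne|exact HA1].
Qed.

Lemma csum_plus g h N : (csum g N + csum h N)%C = csum (fun j => g j + h j)%C N.
Proof.
induction N as [|N IH]; simpl; [ring|]. rewrite <- IH. ring.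
Qed.

Lemma radius_sharp (p n : nat) (m : Z) (alpha beta mu R' : R) :
  (0 < p)%nat -> (0 < n)%nat -> 0 < beta -> 0 < alpha + INR p * beta -> 0 < mu ->
  radius p n alpha beta mu < R' ->
  exists (A B : R) (f : C -> C),
    -1 <= B /\ B < A /\ A <= 1 /\ class_A p n f /\
    subordinate (div_zpow p (Theta p n m alpha beta f)) (Janowski A B) /\
    exists z : C, in_U z /\ Cmod z < R' /\
      Re ((1 - mu) * div_zpow p (Theta p n m alpha beta f) z
          + mu * div_zpow p (Theta p n (m + 1) alpha beta f) z)%C
      <= (1 - A) / (1 - B).
Proof.
intros Hp Hn Hb HD Hm HR'.
destruct (rho_spec p n alpha beta mu Hn Hb HD Hm) as [[Hr0 Hr1] Hr].
cbv zeta in Hr.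
destruct (pow_radius p n alpha beta mu Hn Hr0) as [Hpr Hr2].
set (r := rho p n alpha beta mu) in *. set (rr := radius p n alpha beta mu) in *.
assert (Hrr : rr < 1).
{ apply Rnot_le_lt. intros H. apply (pow_R1_Rle _ n) in H. lra. }
(* The modulus of the bad point: beyond the radius, yet below [R'] and inside the disc. *)
set (r1 := (rr + Rmin R' 1) / 2).
assert (Hmin : rr < Rmin R' 1) by now apply Rmin_glb_lt.
assert (Hr1R : r1 < R') by (pose proof (Rmin_l R' 1); unfold r1; lra).
assert (Hr11 : r1 < 1) by (pose proof (Rmin_r R' 1); unfold r1; lra).
assert (Hrr1 : rr < r1) by (unfold r1; lra).
set (x := r1 ^ n).
assert (Hrx : r < x) by (rewrite <- Hpr; apply pow_lt_mono; [lra|exact Hrr1|exact Hn]).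
assert (Hx1 : x < 1) by (rewrite <- (pow1 n); apply pow_lt_mono; [lra|exact Hr11|exact Hn]).
(* With this choice [th * z^n] is [- r], the critical value, when [z^n = - x]. *)
set (th := r / x).
assert (Hthx : th * x = r) by (unfold th; field; lra).
assert (Hth : 0 < th < 1).
{ split; [apply Rdiv_lt_0_compat; lra|]. apply Rmult_lt_reg_r with x; lra. }
destruct (pow_lt_1_zero th ltac:(rewrite Rabs_pos_eq; lra) ((1 - th ^ 2) / 4)) as [M HM].
{ assert (th ^ 2 < 1) by nra. lra. }
(* Odd for the sign of the remainder at the bad point, large for the half-plane bound on the
   disc. *)
set (N := (2 * M + 1)%nat).
assert (HN : 4 * th ^ S N < 1 - th ^ 2).
{ assert (H := HM (S N) ltac:(unfold N; lia)). rewrite Rabs_pos_eq in H by (apply pow_le; lra). lra. }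
clear HM.
set (lam := fun j => (alpha + INR (p + n * j) * beta) / (alpha + INR p * beta)).
set (de := beta / (alpha + INR p * beta)) in *.
assert (Hde : 0 < de) by now apply Rdiv_lt_0_compat.
assert (Elam : forall j, lam j = 1 + INR n * INR j * de).
{ intros j. unfold lam. rewrite multiplier_eq, mult_INR by exact HD. reflexivity. }
assert (Hlam : forall j, lam j <> 0).
{ intros j. rewrite Elam. pose proof (pos_INR n). pose proof (pos_INR j).
  assert (0 <= INR n * INR j * de) by (apply Rmult_le_pos; [now apply Rmult_le_pos|lra]). lra. }
(* Dividing by the multipliers makes the quotient for [m] equal to [1 + 2 e] times the sum of
   [(th z^n)^j]; [e] is chosen last, when [th] and [N] are fixed. *)
destruct (poly_class_A p n (fun j => RtoC (2 * th ^ j / powerRZ (lam j) m)) N Hp Hn) as (e & [He He1] & HA).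
set (c := fun j => (RtoC e * RtoC (2 * th ^ j / powerRZ (lam j) m))%C) in *.
set (f := poly_fun p n c N) in *.
assert (Em : forall z, div_zpow p (Theta p n m alpha beta f) z =
   (1 + csum (fun j => RtoC (2 * e * th ^ j) * (z ^ n) ^ j) N)%C).
{ intros z. unfold f. rewrite poly_div_zpow by exact Hn. f_equal. apply csum_ext. intros j _.
  fold (lam j). unfold c. rewrite <- !RtoC_mult. do 2 f_equal. field. now apply powerRZ_NOR. }
assert (Em1 : forall z, div_zpow p (Theta p n (m + 1) alpha beta f) z =
   (1 + csum (fun j => RtoC (2 * e * th ^ j * lam j) * (z ^ n) ^ j) N)%C).
{ intros z. unfold f. rewrite poly_div_zpow by exact Hn. f_equal. apply csum_ext. intros j _.
  fold (lam j). unfold c. rewrite <- !RtoC_mult. do 2 f_equal.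
  rewrite powerRZ_add, powerRZ_1 by apply Hlam. field. now apply powerRZ_NOR. }
assert (EG : forall z, div_zpow p (Theta p n m alpha beta f) z =
   (RtoC (1 - e) + RtoC e * (1 + 2 * csum (fun j => (th * z ^ n) ^ j) N))%C).
{ intros z. rewrite Em.
  rewrite (csum_ext _ (fun j => RtoC e * 2 * (th * z ^ n) ^ j)%C).
  - rewrite <- (csum_scal _ (fun j => (th * z ^ n) ^ j)%C), RtoC_minus. ring.
  - intros j _. rewrite Cpow_mult_l, <- RtoC_pow, !RtoC_mult. ring. }
(* Then [kappa = (1 - A) / 2 = 1 - e], the abscissa of the half-plane [1 - e + e G] with
   [Re G > 0]. *)
exists (2 * e - 1), (-1), f.
split; [lra|split; [lra|split; [lra|split; [exact HA|split]]]].
- apply subordinate_half_plane; [lra| | |].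
  + apply analytic_ext with (1 := fun z => eq_sym (EG z)).
    apply analytic_plus; [apply analytic_const|].
    apply (analytic_mult (fun _ => RtoC e)); [apply analytic_const|].
    apply analytic_plus; [apply analytic_const|].
    apply (analytic_mult (fun _ => RtoC 2)); [apply analytic_const|].
    apply (analytic_csum (fun j z => (th * z ^ n) ^ j)%C). intros j. apply analytic_pow.
    apply (analytic_mult (fun _ => RtoC th)); [apply analytic_const|apply analytic_pow, analytic_id].
  + unfold div_zpow. destruct (Ceq_dec (RtoC 0) (RtoC 0)) as [_|H]; [reflexivity|now elim H].
  + intros z Hz. rewrite EG, re_plus, re_scal_l.
    assert (HG := geometric_half_plane (th * z ^ n)%C th N Hth).
    assert (Hmod : Cmod (th * z ^ n)%C <= th).
    { rewrite Cmod_mult, Cmod_R, Cmod_pow, (Rabs_pos_eq th) by lra.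
      assert (Cmod z ^ n <= 1).
      { rewrite <- (pow1 n). apply pow_incr. split; [apply Cmod_ge_0|left; exact Hz]. }
      nra. }
    specialize (HG Hmod HN).
    change (Re (RtoC (1 - e))) with (1 - e). nra.
(* The argument [PI / n] makes [z^n] the negative real number [- x]. *)
- exists (polar (ln r1) (PI / INR n)).
  assert (Hmz : Cmod (polar (ln r1) (PI / INR n)) = r1) by (rewrite Cmod_polar; apply exp_ln; lra).
  split; [unfold in_U; rewrite Hmz; lra|split; [rewrite Hmz; lra|]].
  assert (Hn' : 0 < INR n) by now apply lt_0_INR.
  assert (Ez : (polar (ln r1) (PI / INR n) ^ n)%C = RtoC (- x)).
  { rewrite polar_pow. unfold polar. replace (INR n * (PI / INR n)) with PI by (field; lra).
    rewrite cos_PI, sin_PI, exp_INR_mul, exp_ln by lra. unfold RtoC, x. f_equal; ring. }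
  rewrite Em, Em1, Ez.
  assert (HS := alternating_csum_neg r (mu * de * INR n) M (conj Hr0 Hr1)
     ltac:(apply Rmult_lt_0_compat; [now apply Rmult_lt_0_compat|exact Hn']) ltac:(rewrite Hr; ring)).
  fold N in HS.
  match goal with |- Re ?E <= _ => replace E with
    (RtoC (1 - e) + RtoC e * (1 + 2 * csum (fun j => RtoC (1 + mu * de * INR n * INR j) * RtoC (- r) ^ j) N))%C end.
  + rewrite re_plus, re_scal_l. change (Re (RtoC (1 - e))) with (1 - e).
    replace ((1 - (2 * e - 1)) / (1 - -1)) with (1 - e) by field. nra.
  + rewrite !Cmult_plus_distr_l, !csum_scal.
    (* Termwise, [(1 - mu) + mu * lam j = 1 + mu * de * n * j], and [th * x = r] turns
       [th^j (- x)^j] into [(- r)^j]. *)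
    rewrite (csum_ext (fun j => RtoC e * (2 * _))%C (fun j =>
      (1 - mu) * (RtoC (2 * e * th ^ j) * RtoC (- x) ^ j)
       + mu * (RtoC (2 * e * th ^ j * lam j) * RtoC (- x) ^ j))%C).
    * rewrite <- csum_plus, RtoC_minus. ring.
    * intros j _. rewrite Elam, <- !RtoC_pow, <- RtoC_minus, <- !RtoC_mult, <- RtoC_plus. f_equal.
      replace (- r) with (th * - x) by lra. rewrite Rpow_mult_distr. ring.
Qed.

Theorem theorem4p4 :
  forall (p n : nat) (m : Z) (alpha beta mu : R),
    (0 < p)%nat -> (0 < n)%nat -> 0 < beta -> 0 < alpha + INR p * beta -> 0 < mu ->
    (forall (A B : R) (f : C -> C),
       -1 <= B -> B < A -> A <= 1 ->
       class_A p n f ->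
       subordinate (div_zpow p (Theta p n m alpha beta f)) (Janowski A B) ->
       forall z : C, Cmod z < radius p n alpha beta mu ->
         Re ((1 - mu) * div_zpow p (Theta p n m alpha beta f) z
             + mu * div_zpow p (Theta p n (m + 1) alpha beta f) z)%C
         > (1 - A) / (1 - B))
    /\
    (forall R' : R, radius p n alpha beta mu < R' ->
       exists (A B : R) (f : C -> C),
         -1 <= B /\ B < A /\ A <= 1 /\
         class_A p n f /\
         subordinate (div_zpow p (Theta p n m alpha beta f)) (Janowski A B) /\
         exists z : C, in_U z /\ Cmod z < R' /\
           Re ((1 - mu) * div_zpow p (Theta p n m alpha beta f) z
               + mu * div_zpow p (Theta p n (m + 1) alpha beta f) z)%C
           <= (1 - A) / (1 - B)).
Proof.
intros p n m alpha beta mu Hp Hn Hb HD Hm. split.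
- intros A B f HB HBA HA Hf Hsub z Hz. now apply radius_bound.
- intros R' HR'. now apply radius_sharp.
Qed.
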